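(* Let $X$ be a Banach space with a normalized unconditional Schauder basis $\{x_k\}$ and let $\mu$ be the product prior obtained from $\{\gamma_k\}\in\ell^2$ and an i.i.d. sequence $\{\xi_k\}$ of real valued random variables. Suppose that $\xi_k\sim\mathrm{ID}(0,\sigma^2,\lambda)$, where $\sigma>0$ and $\lambda$ is a symmetric and finite Lévy measure on $\mathbb{R}$ such that $\max\{1,|\cdot|^2\}\in L^1(\mathbb{R},\lambda)$. Then $\mu$ is a Radon infinitely divisible probability measure on $X$ with characteristic function $$\hat\mu(\varrho)=\exp\left[-\frac12\sum_{k=1}^\infty\sigma^2\gamma_k^2\varrho(x_k)^2+\sum_{k=1}^\infty\int_{\mathbb{R}}\left(\cos(\gamma_k\varrho(x_k)t_k)-1\right)d\lambda(t_k)\right]\qquad\forall\varrho\in X^*.$$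
   Context: Product prior: given an unconditional Schauder basis $\{x_k\}$ of $X$, a fixed real sequence $\{\gamma_k\}$ and independent real valued random variables $\{\xi_k\}$, the product prior obtained from $\{\gamma_k\}$ and $\{\xi_k\}$ is the law of the random variable $u=\sum_{k=1}^\infty\gamma_k\xi_kx_k$. The characteristic function of a Borel probability measure $\mu$ on $X$ is $\hat\mu(\varrho)=\int_X\exp(i\varrho(u))\,d\mu(u)$, $\varrho\in X^*$. A Radon probability measure $\mu$ on $X$ is infinitely divisible if for each $n\in\mathbb{N}$ there is a Radon probability measure $\mu_{1/n}$ on $X$ with $\mu=(\mu_{1/n})^{*n}$ ($n$-fold convolution). Radon means inner regular on Borel sets. A finite measure $\lambda$ on $\mathbb{R}$ is a Lévy measure if it is positive with $\lambda(\{0\})=0$; symmetric means $\lambda(A)=\lambda(-A)$ for Borel $A$. $\xi\sim\mathrm{ID}(0,\sigma^2,\lambda)$ means that $\xi$ has characteristic function $$\mathbb{E}\exp(iz\xi)=\exp\left(-\tfrac12\sigma^2z^2+\int_{\mathbb{R}}\left(e^{itz}-1-itz\,\mathbf{1}_{\{|t|<1\}}(t)\right)d\lambda(t)\right),\quad z\in\mathbb{R}.$$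
   Formalization: Almost sure convergence in X of the series u = Σ γ_k ξ_k x_k defining the product prior is assumed, since {γ_k} ∈ ℓ² does not guarantee it: in ℓ¹ with the canonical basis, γ_k = 1/k and Gaussian ξ_k the series diverges almost surely. *)

(* Defs.v *)
From HB Require Import structures.
From mathcomp Require Import all_boot all_order all_algebra.
From mathcomp Require Import all_classical all_reals all_analysis.
From mathcomp Require Export complex.
Import Order.TTheory GRing.Theory Num.Theory.
Import numFieldNormedType.Exports.

Set Implicit Arguments.
Unset Strict Implicit.
Unset Printing Implicit Defensive.

Local Open Scope classical_set_scope.
Local Open Scope ring_scope.
Local Open Scope complex_scope.

Section schauder_basis.
Context (R : realType) (X : normedModType R).
Implicit Types (x : nat -> X) (a : nat -> R).

(* Basis vectors (and all other sequences) are indexed from 0. *)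
Definition schauder_basis x :=
  forall y : X, exists! a, series (fun k => a k *: x k) @ \oo --> y.

(* Unconditionality: every basis expansion may be rearranged by an arbitrary
   permutation p of the indices without affecting convergence. *)
Definition unconditional_schauder_basis x :=
  schauder_basis x /\
  forall a (y : X), series (fun k => a k *: x k) @ \oo --> y ->
  forall p : nat -> nat, bijective p ->
    series (fun k => a (p k) *: x (p k)) @ \oo --> y.

Definition normalized x := forall k, `|x k| = 1.

End schauder_basis.

Definition ell2 (R : realType) (a : nat -> R) :=
  cvgn (series (fun k => a k ^+ 2)).

Section complex_integral.
Context (R : realType).

Definition cexp (z : R[i]) : R[i] :=
  (expR (complex.Re z) * cos (complex.Im z))
  +i* (expR (complex.Re z) * sin (complex.Im z)).

Definition cintegral d (T : measurableType d) (mu : {measure set T -> \bar R})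
    (f : T -> R[i]) : R[i] :=
  (\int[mu]_t complex.Re (f t)) +i* (\int[mu]_t complex.Im (f t)).

End complex_integral.

Section random_sequences.
Context d (T : measurableType d) (R : realType) (P : probability T R).
Implicit Type xi : nat -> {RV P >-> R}.

Definition mutually_independent xi :=
  forall (s : seq nat) (A : nat -> set R), uniq s ->
    (forall k, measurable (A k)) ->
    P (\bigcap_(k in [set` s]) (xi k @^-1` A k)) =
      (\prod_(k <- s) P (xi k @^-1` A k))%E.

Definition identically_distributed xi :=
  forall (j k : nat) (A : set R), measurable A ->
    distribution P (xi j) A = distribution P (xi k) A.

Definition iid xi := mutually_independent xi /\ identically_distributed xi.

End random_sequences.

Section levy.
Context (R : realType).
Implicit Type lambda : {finite_measure set (measurableTypeR R) -> \bar R}.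

(* Positivity is part of the type of lambda. *)
Definition levy_measure lambda := lambda [set 0] = 0%E.

Definition symmetric_measure lambda :=
  forall A : set R, measurable A -> lambda A = lambda ((fun t => - t) @` A).

(* The law ID(0, s2, lambda), where s2 is the Gaussian variance. *)
Definition ID0 d (T : measurableType d) (P : probability T R)
    (xi : {RV P >-> R}) (s2 : R) lambda :=
  forall z : R,
    cintegral P (fun w => cexp (0 +i* (z * xi w))) =
    cexp (- (2^-1 * s2 * z ^+ 2)%:C +
          cintegral lambda (fun t : measurableTypeR R =>
            cexp (0 +i* (t * z)) - 1
            - (0 +i* (t * z * \1_[set r : R | `|r| < 1] t)))).

End levy.

(* X with its Borel sigma-algebra; convertible to X as a type. *)
Definition borel (R : realType) (X : normedModType R) :=
  g_sigma_algebraType (@open X).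

Section measures_on_X.
Context (R : realType) (X : normedModType R).
Implicit Types mu nu : probability (borel X) R.

Definition charfun mu (rho : X -> R) : R[i] :=
  cintegral mu (fun u : borel X => cexp (0 +i* rho u)).

Definition radon mu :=
  forall A : set (borel X), measurable A ->
    mu A = ereal_sup [set mu K | K in
      [set K : set X | compact K /\ K `<=` A]].

(* (mu * nu)(A) = \int mu(dx) nu(A - x).  Working with set functions avoids
   bundling the n-fold powers as measures. *)
Definition convolution (mu nu : set (borel X) -> \bar R)
    (A : set (borel X)) : \bar R :=
  (\int[mu]_x nu [set y : X | A ((x : X) + y)%R])%E.

Definition convolution_power nu (n : nat) : set (borel X) -> \bar R :=
  iter n (convolution nu) \d_((0 : X) : borel X).

Definition infinitely_divisible mu :=
  forall n : nat, (0 < n)%N ->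
    exists nu : probability (borel X) R, radon nu /\
      forall A : set (borel X), measurable A -> mu A = convolution_power nu n A.

End measures_on_X.

(* mu is the law of u = \sum_k gamma_k xi_k x_k, the series being understood
   as converging almost surely in X to the random variable u. *)
Definition product_prior (R : realType) (X : normedModType R)
    d (T : measurableType d) (P : probability T R)
    (x : nat -> X) (gamma : nat -> R) (xi : nat -> {RV P >-> R})
    (mu : probability (borel X) R) :=
  exists u : {mfun T >-> borel X},
    {ae P, forall w,
      series (fun k => (gamma k * xi k w) *: x k) @ \oo --> (u w : X)} /\
    forall A : set (borel X), measurable A -> mu A = distribution P u A.

(* Main.v *)
Require Import Defs.
From HB Require Import structures.
From mathcomp Require Import all_boot all_order all_algebra.
From mathcomp Require Import all_classical all_reals all_analysis.
From mathcomp Require Import complex.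
From mathcomp Require Import measurable_realfun ring lra.
Import Order.TTheory GRing.Theory Num.Theory.
Import numFieldNormedType.Exports.

(** Write [rsum a] for the sum of the series with terms
    [(gamma k * a k) *: x k], defined for the sequences [a] along which it
    converges, and [Q] for the law of the sequence [xi].  The prior is the image
    of [Q] under [rsum] ([product_prior_rsum_law]), and everything is read off
    from this description.

    It is Radon because every Borel law on a complete separable space is
    ([borel_prob_radon]): Borel sets are approximated from inside by closed sets,
    and the law is tight.  Separability comes from the rational combinations of
    the basis vectors ([basis_dense_seq]).

    Infinite divisibility holds already for the law [q] of one coefficient.  The
    sum of a Gaussian variable of variance [sigma ^+ 2 / n] and of a Poisson
    number of jumps, with jump measure [lambda / n], is an [n]-th root of it
    ([gauss_poisson_root]).  Let [eta] be a sequence of independent variables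
    with this law.  A sum of [n] independent copies of [eta] has law [Q], and
    [rsum] is linear, so the law of [rsum eta] should be an [n]-th convolution
    root of the prior.  The point is that the series converges almost surely
    along [eta], and symmetry gives this.  If [b] is the sum of the [n - 1] other copies, then [eta + b] and [eta - b]
    both have law [Q], the series converges almost surely along both, and [eta]
    is half their sum ([rcvg_convS_convNS], [rsum_law_root]).  The sequence [eta]
    is realised as an image of [xi]: since the Gaussian part makes [q] atomless,
    a function of one coefficient can have any prescribed law
    ([quantile_transform]).  Laws on the line are identified through their
    characteristic functions ([eq_charfun_prob]).

    Finally, a continuous functional [rho] sends the partial sums to finite linear
    combinations of independent variables, whose characteristic functions are
    products ([iid_charfun_sum]), and dominated convergence passes to the limit
    ([charfun_rsum_law]).  By symmetry of [lambda] only cosines survive.  The two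
    series of the exponent converge because [rho] is bounded on the unit sphere,
    [gamma] is square summable, [1 - cos y <= y ^+ 2 / 2], and [lambda] has a
    finite second moment. *)

Set Implicit Arguments.
Unset Strict Implicit.
Unset Printing Implicit Defensive.

Local Open Scope classical_set_scope.
Local Open Scope ring_scope.

(** * Image laws and product laws *)

Lemma finite_measure_bounded_integrable d (R : realType)
    (T : measurableType d) (P : {finite_measure set T -> \bar R})
    (f : T -> R) M : measurable_fun setT f -> (forall x, `|f x| <= M) ->
  P.-integrable setT (EFin \o f).
Proof.
move=> mf fM; apply: measurable_bounded_integrable => //.
  by rewrite -ge0_fin_numE// fin_num_measure.
by exists M; split=> [|M' MM' x _ /=]; [exact: num_real|exact: le_trans (fM x) (ltW MM')].
Qed.

Section image_law.
Context d1 (T1 : measurableType d1) d2 (T2 : measurableType d2) (R : realType).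

Definition image_prob (P : probability T1 R) (f : T1 -> T2)
    (mf : measurable_fun [set: T1] f) : probability T2 R :=
  distribution P (mfun_Sub (mem_set mf)).

Lemma image_probE (P : probability T1 R) (f : T1 -> T2) (mf : measurable_fun [set: T1] f) A :
  image_prob P mf A = P (f @^-1` A).
Proof. by []. Qed.

Lemma ge0_integral_image (P : probability T1 R) (f : T1 -> T2) (mf : measurable_fun [set: T1] f)
    (g : T2 -> \bar R) :
  measurable_fun [set: T2] g -> (forall y, 0 <= g y)%E ->
  (\int[image_prob P mf]_y g y = \int[P]_x g (f x))%E.
Proof. by move=> mg g0; rewrite ge0_integral_pushforward. Qed.

Lemma Rintegral_image (P : probability T1 R) (f : T1 -> T2) (mf : measurable_fun [set: T1] f) (g : T2 -> R) M :
  measurable_fun [set: T2] g -> (forall y, `|g y| <= M) ->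
  \int[image_prob P mf]_y g y = \int[P]_x g (f x).
Proof.
move=> mg gM; rewrite /Rintegral integral_pushforward//.
  exact/measurable_EFinP.
apply: (@finite_measure_bounded_integrable _ _ _ P (g \o f) M) => //=.
exact: measurableT_comp.
Qed.

End image_law.

Section product_prob.
Context d1 (T1 : measurableType d1) d2 (T2 : measurableType d2) (R : realType).
Variables (P1 : probability T1 R) (P2 : probability T2 R).

Definition product_prob : probability (T1 * T2)%type R := (P1 \x P2)%E.

Lemma product_probX A B : measurable A -> measurable B ->
  product_prob (A `*` B) = (P1 A * P2 B)%E.
Proof. exact: product_measure1E. Qed.

Lemma product_prob_fubini (A : set (T1 * T2)) : measurable A ->
  product_prob A = (\int[P1]_x P2 [set y | A (x, y)])%E.
Proof.
move=> mA; apply: eq_integral => x _ /=; congr (P2 _).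
by apply/seteqP; split => y /=; rewrite /xsection/= inE.
Qed.

Section bounded.
Variables (f : T1 * T2 -> R) (M : R).
Hypotheses (mf : measurable_fun setT f) (fM : forall x, `|f x| <= M).

Let intf : product_prob.-integrable setT (EFin \o f).
Proof. exact: finite_measure_bounded_integrable fM. Qed.

Lemma bounded_fubini1 :
  \int[P1]_x \int[P2]_y f (x, y) = \int[product_prob]_z f z.
Proof.
rewrite {1 3}/Rintegral -integral12_prod_meas1//; congr fine.
apply: eq_integral => x _; rewrite /Rintegral/= fineK//.
apply: integrable_fin_num => //.
apply: (@finite_measure_bounded_integrable _ _ _ P2 (fun y => f (x, y)) M) => //.
exact: measurableT_comp.
Qed.

Lemma bounded_fubini2 :
  \int[P2]_y \int[P1]_x f (x, y) = \int[product_prob]_z f z.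
Proof.
rewrite {1 3}/Rintegral -integral21_prod_meas1//; congr fine.
apply: eq_integral => x _; rewrite /Rintegral/= fineK//.
apply: integrable_fin_num => //.
apply: (@finite_measure_bounded_integrable _ _ _ P1 (fun y => f (y, x)) M) => //.
exact: measurableT_comp.
Qed.

End bounded.
End product_prob.

Lemma Rintegral_dominated_cvg d (R : realType) (T : measurableType d)
    (mu : {measure set T -> \bar R}) (f_ : nat -> T -> R) (f G : T -> R) :
  (forall n, measurable_fun setT (f_ n)) -> measurable_fun setT f ->
  {ae mu, forall x, f_ ^~ x @ \oo --> f x} ->
  mu.-integrable setT (EFin \o G) ->
  (forall n x, `|f_ n x| <= G x) ->
  \int[mu]_x f_ n x @[n --> \oo] --> \int[mu]_x f x.
Proof.
move=> mf_ mf cf iG fG.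
have [||||ifin _ cvgi] := @dominated_convergence _ _ _ mu setT measurableT
  (fun n => EFin \o f_ n) (EFin \o f) (EFin \o G) _ _ _ iG.
- by move=> n; exact/measurable_EFinP.
- exact/measurable_EFinP.
- apply: filterS cf => x cfx _.
  by apply: cvg_EFin; [exact: nearW|exact: cfx].
- by apply: aeW => x n _ /=; rewrite lee_fin.
apply: fine_cvg; rewrite -/(Rintegral _ _ _) /Rintegral fineK //.
exact: integrable_fin_num.
Qed.

(** * Trigonometric integrands *)

Section trigonometric_integrands.
Context (R : realType).

Lemma measurable_cosM (z : R) : measurable_fun setT (fun x : R => cos (z * x)).
Proof.
apply: continuous_measurable_fun => x.
by apply: continuous_comp; [exact: mulrl_continuous|exact: continuous_cos].
Qed.

Lemma measurable_sinM (z : R) : measurable_fun setT (fun x : R => sin (z * x)).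
Proof.
apply: continuous_measurable_fun => x.
by apply: continuous_comp; [exact: mulrl_continuous|exact: continuous_sin].
Qed.

Lemma integrable_cosM d (T : measurableType d)
    (P : {finite_measure set T -> \bar R}) (f : T -> R) :
  measurable_fun setT f -> P.-integrable setT (EFin \o (fun x => cos (f x))).
Proof.
move=> mf; apply: (@finite_measure_bounded_integrable _ _ _ _ _ 1) => [|x].
  apply: measurableT_comp => //; apply: continuous_measurable_fun.
  exact: continuous_cos.
exact: cos_max.
Qed.

Lemma integrable_sinM d (T : measurableType d)
    (P : {finite_measure set T -> \bar R}) (f : T -> R) :
  measurable_fun setT f -> P.-integrable setT (EFin \o (fun x => sin (f x))).
Proof.
move=> mf; apply: (@finite_measure_bounded_integrable _ _ _ _ _ 1) => [|x].
  apply: measurableT_comp => //; apply: continuous_measurable_fun.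
  exact: continuous_sin.
exact: sin_max.
Qed.

End trigonometric_integrands.

(** * The Gaussian characteristic function *)

Section gaussian.
Context (R : realType).
Notation mu := (@lebesgue_measure R).
Variable s : R.
Hypothesis s0 : s != 0.

Lemma Rintegral_normal_prob (m : R) (f : R -> R) M :
  measurable_fun setT f -> (forall x, `|f x| <= M) ->
  \int[normal_prob m s]_x f x = \int[mu]_x (f x * normal_pdf m s x).
Proof.
move=> mf fM; rewrite /Rintegral; congr fine.
have intf : (normal_prob m s).-integrable setT (EFin \o f).
  exact: (@finite_measure_bounded_integrable _ R _ (normal_prob m s) f M mf fM).
rewrite -(Radon_Nikodym_change_of_variables (normal_prob_dominates m s))//.
transitivity (\int[mu]_x ((f x)%:E * (normal_pdf m s x)%:E))%E; last first.
  by apply: eq_integral => x _; rewrite EFinM.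
apply: ae_eq_integral => //.
- apply: emeasurable_funM => //; first exact/measurable_EFinP.
  apply: (measurable_int mu).
  by apply: Radon_Nikodym_integrable; exact: normal_prob_dominates.
- apply: emeasurable_funM => //; apply/measurable_EFinP => //.
  exact: measurable_normal_pdf.
- apply: ae_eqe_mul2l => /=.
  rewrite Radon_NikodymE//=; first exact: normal_prob_dominates.
  move=> abmu; case: cid => /= h [h1 h2 h3].
  apply: integral_ae_eq => //=.
  + by apply/measurable_EFinP; exact: measurable_normal_pdf.
  + by move=> E E01 mE; rewrite -h3.
Qed.

Local Notation g := (normal_pdf 0 s).

Lemma is_derive_normal_pdf (x : R) : is_derive x 1 g (- (x / s ^+ 2) * g x).
Proof.
have -> : g = (fun y : R => normal_peak s * expR (- (y ^+ 2 / (s ^+ 2 *+ 2)))).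
  by rewrite normal_pdfE//; apply/funext => y; rewrite /normal_fun subr0 mulNr.
apply: is_derive_eq => /=.
by rewrite /GRing.scale/=; field.
Qed.

(** Since [`|x| <= (1 + 4 * s ^+ 2) * expR (x ^+ 2 / (4 * s ^+ 2))], a factor
    [`|x|] is absorbed by doubling the variance.  This gives the dominating
    function for differentiating under the integral sign, and the decay of the
    boundary terms of the integration by parts. *)
Lemma normr_normal_pdf_le (x : R) : `|x| * g x <=
  (1 + 4 * s ^+ 2) * (normal_peak s / normal_peak (Num.sqrt 2 * s)) *
  normal_pdf 0 (Num.sqrt 2 * s) x.
Proof.
have t0 : Num.sqrt 2 * s != 0 by rewrite mulf_neq0// gt_eqF// sqrtr_gt0.
have p0 := normal_peak_gt0 t0.
rewrite !normal_pdfE// /normal_fun subr0 !exprMn sqr_sqrtr//.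
set a := x ^+ 2 / (4 * s ^+ 2).
have -> : - x ^+ 2 / (s ^+ 2 *+ 2) = - a + - a by rewrite /a; field.
have -> : - x ^+ 2 / ((2 * s ^+ 2) *+ 2) = - a by rewrite /a; field.
rewrite expRD.
have xa : `|x| <= (1 + 4 * s ^+ 2) * expR a.
  have a0 : 0 <= a by rewrite divr_ge0 ?sqr_ge0// mulr_ge0// sqr_ge0.
  have e1 : 1 <= expR a by rewrite -expR0 ler_expR.
  have e2 : a <= expR a by rewrite (le_trans _ (expR_ge1Dx a))// lerDr.
  have -> : (1 + 4 * s ^+ 2) * expR a = expR a + 4 * s ^+ 2 * expR a by ring.
  apply: (@le_trans _ _ (1 + x ^+ 2)).
    have := sqr_ge0 (`|x| - 1); rewrite sqrrB1 -normrX ger0_norm ?sqr_ge0//.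
    have := normr_ge0 x; rewrite -mulr_natr; lra.
  apply: lerD => //; have -> : x ^+ 2 = 4 * s ^+ 2 * a by rewrite /a; field.
  by rewrite ler_wpM2l// mulr_ge0// sqr_ge0.
have pk0 := normal_peak_ge0 s.
have e0 := expR_gt0 (- a).
have -> : (1 + 4 * s ^+ 2) * (normal_peak s / normal_peak (Num.sqrt 2 * s)) *
    (normal_peak (Num.sqrt 2 * s) * expR (- a)) =
    ((1 + 4 * s ^+ 2) * expR a) *
    (normal_peak s * (expR (- a) * expR (- a))).
  rewrite !expRN; field.
  by rewrite (gt_eqF p0) gt_eqF ?expR_gt0.
by rewrite ler_wpM2r// mulr_ge0// mulr_ge0// ltW.
Qed.

Lemma measurable_normr_normal_pdf :
  measurable_fun setT (fun x : R => `|x| * g x).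
Proof.
apply: measurable_funM; last exact: measurable_normal_pdf.
by apply: continuous_measurable_fun; exact: norm_continuous.
Qed.

Lemma integrable_normr_normal_pdf :
  mu.-integrable setT (EFin \o (fun x => `|x| * g x)).
Proof.
have := integrable_normal_pdf 0 (Num.sqrt 2 * s).
move=> /(integrableZl measurableT
  ((1 + 4 * s ^+ 2) * (normal_peak s / normal_peak (Num.sqrt 2 * s)))).
apply: le_integrable => //.
  by apply/measurable_EFinP; exact: measurable_normr_normal_pdf.
move=> x _ /=; rewrite lee_fin [leLHS]ger0_norm.
  exact: le_trans (normr_normal_pdf_le x) (ler_norm _).
by rewrite mulr_ge0// normal_pdf_ge0.
Qed.

Let continuous_cosz (z : R) : continuous (fun x : R => cos (z * x)).
Proof.
move=> x; apply: continuous_comp; last exact: continuous_cos.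
exact: mulrl_continuous.
Qed.

Let continuous_sinz (z : R) : continuous (fun x : R => sin (z * x)).
Proof.
move=> x; apply: continuous_comp; last exact: continuous_sin.
exact: mulrl_continuous.
Qed.

Let integrable_cos_normal (z : R) :
  mu.-integrable setT (EFin \o (fun x => cos (z * x) * g x)).
Proof.
have := integrable_normal_pdf 0 s; apply: le_integrable => //.
  apply/measurable_EFinP; apply: measurable_funM.
    exact: measurable_cosM.
  exact: measurable_normal_pdf.
move=> x _ /=; rewrite lee_fin normrM ler_piMl//.
exact: cos_max.
Qed.

Let integrable_sin_normal (z : R) :
  mu.-integrable setT (EFin \o (fun x => x * sin (z * x) * g x)).
Proof.
have := integrable_normr_normal_pdf; apply: le_integrable => //.
  apply/measurable_EFinP; apply: measurable_funM.
    by apply: measurable_funM => //; exact: measurable_sinM.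
  exact: measurable_normal_pdf.
move=> x _ /=; rewrite lee_fin !normrM normr_id -!mulrA ler_wpM2l//.
by rewrite ler_piMl// sin_max.
Qed.

Let cosint (z : R) := \int[mu]_x (cos (z * x) * g x).

Let sinint (z : R) := \int[mu]_x (x * sin (z * x) * g x).

(** The function whose derivative relates the integrands of [cosint] and
    [sinint]. *)
Let bdry (z x : R) := sin (z * x) * g x.

Let dbdry (z x : R) := z * (cos (z * x) * g x) - s ^- 2 * (x * sin (z * x) * g x).

Let is_derive_bdry (z x : R) : is_derive x 1 (bdry z) (dbdry z x).
Proof.
have := is_derive_normal_pdf x => gx.
apply: is_derive_eq; rewrite /dbdry /GRing.scale/=; field.
by [].
Qed.

Let continuous_bdry (z : R) : continuous (bdry z).
Proof.
move=> x; apply/differentiable_continuous/derivable1_diffP.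
by apply: ex_derive; exact: is_derive_bdry.
Qed.

Let cg : continuous g. Proof. exact: continuous_normal_pdf. Qed.

Let continuous_dbdry (z : R) : continuous (dbdry z).
Proof.
move=> x; apply: cvgB; apply: cvgM; try exact: cvg_cst.
  by apply: cvgM; [exact: continuous_cosz|exact: cg].
apply: cvgM; last exact: cg.
by apply: cvgM; [exact: cvg_id|exact: continuous_sinz].
Qed.

(** From [`|x| * g x <= K] one gets [g x <= K / `|x|], which is all the decay
    at infinity that the integration by parts needs. *)
Let bdry_le (z : R) : exists C, forall n : nat,
  `|bdry z n.+1%:R - bdry z (- n.+1%:R)| <= C / n.+1%:R.
Proof.
pose K := (1 + 4 * s ^+ 2) * (normal_peak s / normal_peak (Num.sqrt 2 * s)) *
  normal_peak (Num.sqrt 2 * s).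
have gK x : 0 < `|x| -> g x <= K / `|x|.
  move=> x0; rewrite ler_pdivlMr// mulrC (le_trans (normr_normal_pdf_le x))//.
  rewrite /K ler_wpM2l//.
    by rewrite mulr_ge0 ?divr_ge0 ?normal_peak_ge0// addr_ge0// mulr_ge0// sqr_ge0.
  by rewrite normal_pdf_ub// mulf_neq0// gt_eqF// sqrtr_gt0.
have bK x : 0 < `|x| -> `|bdry z x| <= K / `|x|.
  move=> x0; rewrite normrM (le_trans _ (gK _ x0))//.
  by rewrite [`|g x|]ger0_norm ?normal_pdf_ge0// ler_piMl ?normal_pdf_ge0// sin_max.
exists (K + K) => n; rewrite (le_trans (ler_normB _ _))// mulrDl lerD//.
  by have := bK n.+1%:R; rewrite normr_nat; apply.
by have := bK (- n.+1%:R); rewrite normrN normr_nat; apply.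
Qed.

Let integrable_dbdry (z : R) : mu.-integrable setT (EFin \o dbdry z).
Proof.
have -> : EFin \o dbdry z = (fun x => z%:E * (cos (z * x) * g x)%:E
    - (s ^- 2)%:E * (x * sin (z * x) * g x)%:E)%E.
  by apply/funext => x; rewrite /= /dbdry EFinB !EFinM.
apply: integrableB => //.
  exact: (integrableZl measurableT z (integrable_cos_normal z)).
exact: (integrableZl measurableT (s ^- 2) (integrable_sin_normal z)).
Qed.

Let integral_dbdry_itv z (n : nat) :
  \int[mu]_x (dbdry z x * \1_`[- n.+1%:R, n.+1%:R]%classic x) =
  bdry z n.+1%:R - bdry z (- n.+1%:R).
Proof.
have nn : (- n.+1%:R < n.+1%:R :> R)%R by rewrite gtrN// ltr0n.
have := @continuous_FTC2 R (dbdry z) (bdry z) _ _ nn.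
have cd : {within `[- n.+1%:R, n.+1%:R]%classic, continuous (dbdry z)}.
  exact/continuous_subspaceT/continuous_dbdry.
have db : derivable_oo_LRcontinuous (bdry z) (- n.+1%:R) n.+1%:R.
  split.
  - by move=> x _; apply: ex_derive; exact: is_derive_bdry.
  - by apply: cvg_at_right_filter; exact: continuous_bdry.
  - by apply: cvg_at_left_filter; exact: continuous_bdry.
move=> /(_ cd db).
have dE : {in `]- n.+1%:R, n.+1%:R[, (bdry z)^`()%classic =1 dbdry z}.
  by move=> x _; rewrite derive1E; apply: derive_val; exact: is_derive_bdry.
move=> /(_ dE) H.
rewrite /Rintegral -[RHS]/(fine (bdry z n.+1%:R - bdry z (- n.+1%:R))%:E).
rewrite EFinB -H [in RHS]integral_mkcond; congr fine; apply: eq_integral => x _.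
rewrite patchE indicE; case: ifPn => _ /=; first by rewrite mulr1.
by rewrite mulr0.
Qed.

Let integral_dbdry (z : R) : \int[mu]_x dbdry z x = 0.
Proof.
have [C bC] := bdry_le z.
have c1 : \int[mu]_x (dbdry z x * \1_`[- n.+1%:R, n.+1%:R]%classic x)
    @[n --> \oo] --> \int[mu]_x dbdry z x.
  apply: (@Rintegral_dominated_cvg _ R _ mu _ _ (fun x => `|dbdry z x|)).
  - move=> n; apply: measurable_funM; last exact: measurable_indic.
    by apply: continuous_measurable_fun; exact: continuous_dbdry.
  - by apply: continuous_measurable_fun; exact: continuous_dbdry.
  - apply: aeW => x; apply: cvg_near_cst; near=> n.
    rewrite indicE mem_set ?mulr1//= in_itv/= -ler_norml.
    near: n; exists (Num.truncn `|x|) => // n /= xn.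
    by rewrite ltW// (lt_le_trans (truncnS_gt _))// ler_nat.
  - have := integrable_dbdry z; apply: le_integrable => //.
      apply/measurable_EFinP; apply: measurableT_comp => //.
      by apply: continuous_measurable_fun; exact: continuous_dbdry.
    by move=> x _ /=; rewrite normr_id.
  - move=> n x; rewrite normrM ler_piMr// indicE.
    by case: (_ \in _); rewrite ?normr1 ?normr0.
have c2 : \int[mu]_x (dbdry z x * \1_`[- n.+1%:R, n.+1%:R]%classic x)
    @[n --> \oo] --> (0 : R).
  under eq_fun do rewrite integral_dbdry_itv.
  apply/norm_cvg0P.
  apply: (@squeeze_cvgr _ _ _ _ (fun=> 0) (fun n => C * harmonic n)).
  - by near=> n; rewrite normr_ge0 bC.
  - exact: cvg_cst.
  - by rewrite -[X in _ --> X](mulr0 C); apply: cvgMr; exact: cvg_harmonic.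
by apply: cvg_unique c1 c2.
Unshelve. all: by end_near. Qed.

(** With [cosint^`() = - sinint], this is the differential equation
    [cosint^`() z = - s ^+ 2 * z * cosint z]. *)
Let sinintE (z : R) : sinint z = s ^+ 2 * z * cosint z.
Proof.
have := integral_dbdry z.
rewrite /dbdry RintegralB//; last 2 first.
  exact: (integrableZl measurableT z (integrable_cos_normal z)).
  exact: (integrableZl measurableT (s ^- 2) (integrable_sin_normal z)).
rewrite RintegralZl// RintegralZl// -/(cosint z) -/(sinint z).
move=> /eqP; rewrite subr_eq0 => /eqP H.
by rewrite -mulrA H mulrA divff ?mul1r// sqrf_eq0.
Qed.

Let is_derive_cosint (z : R) : is_derive z 1 cosint (- sinint z).
Proof.
pose f (y x : R) := cos (y * x) * g x.
have df (y x : R) : is_derive y 1 (f ^~ x) (- (x * sin (y * x) * g x)).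
  apply: is_derive_eq; rewrite /GRing.scale/=; ring.
have ddf (y x : R) : derivable (f ^~ x) y 1.
  by apply: ex_derive; exact: df.
have d1E (y x : R) : (f ^~ x)^`()%classic y = - (x * sin (y * x) * g x).
  by rewrite derive1E; apply: derive_val.
have zI : (`]z - 1, z + 1[%classic : set R) z by rewrite /= in_itv/=; lra.
have H1 := @derivable_under_integral R _ _ mu f setT measurableT z (z - 1) (z + 1)
  zI (fun y _ => integrable_cos_normal y) (fun y x _ _ => ddf y x)
  (fun x => `|x| * g x) (fun x => mulr_ge0 (normr_ge0 _) (normal_pdf_ge0 _ _ _))
  integrable_normr_normal_pdf.
have H2 := @differentiation_under_integral R _ _ mu f setT measurableT z (z - 1) (z + 1)
  zI (fun y _ => integrable_cos_normal y) (fun y x _ _ => ddf y x)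
  (fun x => `|x| * g x) (fun x => mulr_ge0 (normr_ge0 _) (normal_pdf_ge0 _ _ _))
  integrable_normr_normal_pdf.
have b (x y : R) : (`]z - 1, z + 1[%classic : set R) x -> setT y ->
   `|partial1of2 f x y| <= `|y| * g y.
  move=> _ _; rewrite /partial1of2 d1E normrN !normrM -mulrA ler_wpM2l//.
  by rewrite [`|g y|]ger0_norm ?normal_pdf_ge0// ler_piMl ?normal_pdf_ge0// sin_max.
have {}H1 := H1 b; have {}H2 := H2 b.
apply: DeriveDef => //.
rewrite -derive1E H2.
transitivity (\int[mu]_y (- 1 * (y * sin (z * y) * g y))).
  by apply: eq_Rintegral => y _; rewrite /partial1of2 d1E mulN1r.
by rewrite RintegralZl// mulN1r.
Qed.

(** Both sides equal 1 at 0 and solve the same linear differential equation: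
    the quotient [H] of the two has derivative zero. *)
Lemma normal_prob_cos (z : R) :
  \int[normal_prob 0 s]_x cos (z * x) = expR (- (s ^+ 2 * z ^+ 2 / 2)).
Proof.
rewrite (@Rintegral_normal_prob _ _ 1); last 2 first.
- exact: measurable_cosM.
- by move=> x; exact: cos_max.
rewrite -/(cosint z).
pose H (y : R) := cosint y * expR (s ^+ 2 * y ^+ 2 / 2).
have dH (y : R) : is_derive y (1 : R) H 0.
  have := is_derive_cosint y => dc.
  apply: is_derive_eq; by rewrite sinintE /GRing.scale/=; field.
have := is_derive_0_is_cst z 0 dH.
rewrite /H expr0n/= mulr0 mul0r expR0 mulr1.
have -> : cosint 0 = 1.
  rewrite /cosint; under eq_Rintegral do rewrite mul0r cos0 mul1r.
  by rewrite /Rintegral integral_normal_pdf.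
move=> e1; rewrite expRN -[RHS]mul1r; apply: canRL (mulfK _) e1.
by rewrite gt_eqF// expR_gt0.
Qed.

End gaussian.

(** * Uniqueness of characteristic functions on the line *)

Section distribution_function.
Context (R : realType).
Implicit Types P Q : probability R R.

Definition dfun P (r : R) : R := fine (P `]-oo, r]%classic).

Let idR : {mfun R >-> R} := mfun_Sub (mem_set (@measurable_id _ R setT)).

Lemma EFin_dfun P r : (dfun P r)%:E = P `]-oo, r]%classic.
Proof. by rewrite fineK// fin_num_measure. Qed.

Let cdfE P r : (dfun P r)%:E = @cdf _ _ _ P idR r.
Proof. by rewrite EFin_dfun. Qed.

Lemma dfun_ge0 P r : 0 <= dfun P r.
Proof. by rewrite -lee_fin EFin_dfun. Qed.

Lemma dfun_le1 P r : dfun P r <= 1.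
Proof. by rewrite -lee_fin EFin_dfun probability_le1. Qed.

Lemma dfun_nondecreasing P : {homo dfun P : x y / x <= y}.
Proof.
by move=> x y xy; rewrite -lee_fin !cdfE; exact: cdf_nondecreasing.
Qed.

Lemma measurable_dfun P : measurable_fun setT (dfun P).
Proof.
apply/measurable_EFinP; have := @cdf_measurable _ _ _ P idR.
by apply: eq_measurable_fun => r _; rewrite -cdfE.
Qed.

Lemma dfun_cvg1 P : dfun P x @[x --> +oo] --> (1 : R).
Proof. exact: (fine_cvg (@cvg_cdfy1 _ _ _ P idR)). Qed.

Lemma dfun_cvg0 P : dfun P x @[x --> -oo] --> (0 : R).
Proof. exact: (fine_cvg (@cvg_cdfNy0 _ _ _ P idR)). Qed.

Lemma dfun_right_continuous P : right_continuous (dfun P).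
Proof.
move=> a; apply: fine_cvg; rewrite -/(dfun P a) cdfE.
exact: cdf_right_continuous.
Qed.

(** The mass of a half-open interval is a difference of two values of the
    distribution function, and these intervals form a generating class closed
    under intersection. *)
Lemma eq_dfun_prob P Q : dfun P =1 dfun Q ->
  forall A, measurable A -> P A = Q A.
Proof.
move=> PQ; apply: (measure_unique (@ocitv R)
  (fun n => `]- n%:R, n%:R]%classic)) => //.
- exact: ocitvI.
- by move=> i; exact: is_ocitv.
- rewrite -subTset => x _; exists (Num.truncn `|x|).+1 => //=.
  have : `|x| < (Num.truncn `|x|).+1%:R by exact: truncnS_gt.
  by rewrite in_itv/= ltr_norml => /andP[-> /ltW].
- move=> A [[a b] _ <-] /=.
  have [ab|ba] := leP a b; last first.
    by rewrite set_itv_ge ?measure0// bnd_simp -leNgt ltW.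
  have E (S : probability R R) : S `]a, b]%classic = (dfun S b - dfun S a)%:E.
    have I : `]-oo, b]%classic `&` `]-oo, a]%classic = `]-oo, a]%classic :> set R.
      by apply: setIidr => x /=; rewrite !in_itv/= => /le_trans; exact.
    rewrite EFinB !EFin_dfun -[in X in (_ - X)%E]I -measureD//; last first.
      by rewrite -ge0_fin_numE// fin_num_measure.
    congr (S _); apply/seteqP; split => x /=; rewrite !in_itv/=.
      by move=> /andP[ax xb]; split => //; apply/negP; rewrite -ltNge.
    by move=> [-> /negP]; rewrite -ltNge => ->.
  by rewrite !E !PQ.
- by move=> k; rewrite -ge0_fin_numE// fin_num_measure.
Qed.

End distribution_function.

Section gaussian_law.
Context (R : realType).

Let measurable_idR : measurable_fun setT (fun x : measurableTypeR R => x : R).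
Proof. exact: measurable_id. Qed.

(** The normal law lives on the line with the sigma-algebra of Lebesgue
    measure theory, which has another display than the Borel structure carried
    by [R]; the image under the identity moves it to the latter. *)
Definition gaussian (s : R) : probability R R :=
  image_prob (normal_prob 0 s) measurable_idR.

Lemma gaussian_cos (s z : R) : s != 0 ->
  \int[gaussian s]_x cos (z * x) = expR (- (s ^+ 2 * z ^+ 2 / 2)).
Proof.
move=> s0; rewrite -normal_prob_cos//.
rewrite (@Rintegral_image _ _ _ _ _ _ _ measurable_idR _ 1)//.
  exact: measurable_cosM.
by move=> x; exact: cos_max.
Qed.

End gaussian_law.

Section lebesgue_translation.
Context (R : realType) (T : R).
Notation mu := (@lebesgue_measure R).

Let measurable_shiftT :
  measurable_fun setT (fun x : measurableTypeR R => x + T : measurableTypeR R).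
Proof.
have : measurable_fun setT (fun x : R => x + T) by exact: measurable_funD.
exact.
Qed.

Let shiftT : {mfun measurableTypeR R >-> measurableTypeR R} :=
  mfun_Sub (mem_set measurable_shiftT).

Lemma lebesgue_measure_shift (A : set (measurableTypeR R)) : measurable A ->
  pushforward mu shiftT A = mu A.
Proof.
move=> mA; apply/esym/lebesgue_measure_unique => //= _ [[a b]] _ <-.
rewrite /pushforward/=.
have -> : (fun x : R => x + T) @^-1` `]a, b]%classic = `]a - T, b - T]%classic.
  by apply/seteqP; split => x /=; rewrite !in_itv/= ltrBlDr lerBrDr.
rewrite !lebesgue_measure_itv/= !lte_fin ltrD2r.
by case: ifPn => // _; rewrite -!EFinB; congr EFin; ring.
Qed.

(** A translation turns the moving half-line into a fixed one, so that the
    translation parameter only occurs in the integrand and the order of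
    integration can be exchanged in [smooth] below. *)
Lemma normal_prob_shift s : normal_prob 0 s `]-oo, T]%classic =
  (\int[mu]_(u in `]-oo, 0%R]) (normal_pdf 0 s (u + T))%:E)%E.
Proof.
transitivity (\int[pushforward mu shiftT]_(x in `]-oo, T]) (normal_pdf 0 s x)%:E)%E.
  rewrite /normal_prob; apply: eq_measure_integral => //= A mA _.
  exact/esym/lebesgue_measure_shift.
rewrite ge0_integral_pushforward//=; last first.
- by move=> x _; rewrite lee_fin normal_pdf_ge0.
- by apply/measurable_EFinP/measurable_funTS; exact: measurable_normal_pdf.
congr (integral _ _ _); apply/seteqP; split => x /=; rewrite !in_itv/=.
  by rewrite -lerBrDr subrr.
by rewrite -lerBrDr subrr.
Qed.

End lebesgue_translation.

Section charfun_unique.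
Context (R : realType) (P Q : probability R R).
Hypothesis cosPQ : forall z, \int[P]_x cos (z * x) = \int[Q]_x cos (z * x).
Hypothesis sinPQ : forall z, \int[P]_x sin (z * x) = \int[Q]_x sin (z * x).
Notation mu := (@lebesgue_measure R).

Let N := gaussian (1 : R).

(** A Gaussian bump is itself a Gaussian average of cosines, by
    [normal_prob_cos].  Its integral is therefore an expression in the
    characteristic function of [S]. *)
Let gauss_test (S : probability R R) (k b : R) :
  \int[S]_x expR (- ((k * x - b) ^+ 2 / 2)) =
  \int[N]_z (cos (b * z) * \int[S]_x cos (z * k * x) +
             sin (b * z) * \int[S]_x sin (z * k * x)).
Proof.
have E (x : R) : expR (- ((k * x - b) ^+ 2 / 2)) =
    \int[N]_z cos ((k * x - b) * z).
  by rewrite gaussian_cos ?oner_neq0// expr1n mul1r.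
under eq_Rintegral do rewrite E.
pose f (p : R * R) := cos ((k * p.1 - b) * p.2).
have mf : measurable_fun setT f.
  apply: measurableT_comp; first by apply: continuous_measurable_fun; exact: continuous_cos.
  apply: measurable_funM; last exact: measurable_snd.
  by apply: measurable_funB => //; apply: measurable_funM => //; exact: measurable_fst.
have fb p : `|f p| <= 1 by exact: cos_max.
rewrite [LHS](bounded_fubini1 S N mf fb) -(bounded_fubini2 S N mf fb).
apply: eq_Rintegral => z _; rewrite /f/=.
have ic (c : R) : S.-integrable setT (EFin \o (fun x => cos (c * x))).
  by apply: integrable_cosM; exact: measurable_funM.
have is_ (c : R) : S.-integrable setT (EFin \o (fun x => sin (c * x))).
  by apply: integrable_sinM; exact: measurable_funM.
rewrite -RintegralZl// -RintegralZl// -RintegralD//; last 2 first.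
- exact: (integrableZl measurableT (cos (b * z)) (ic (z * k))).
- exact: (integrableZl measurableT (sin (b * z)) (is_ (z * k))).
apply: eq_Rintegral => x _.
have -> : (k * x - b) * z = z * k * x - b * z by ring.
by rewrite cosB mulrC [sin _ * sin _]mulrC.
Qed.

Let gauss_testPQ (k b : R) :
  \int[P]_x expR (- ((k * x - b) ^+ 2 / 2)) =
  \int[Q]_x expR (- ((k * x - b) ^+ 2 / 2)).
Proof.
by rewrite !gauss_test; apply: eq_Rintegral => z _; rewrite cosPQ sinPQ.
Qed.

Let g := normal_pdf (0 : R) 1.

(** The left-hand side is the value at [c] of the distribution function of
    [x + z / k] where [x] has law [S] and [z] is an independent standard
    Gaussian variable, for [k > 0]. *)
Let smooth (S : probability R R) (k c : R) :
  (\int[S]_x N `]-oo, (k * (c - x))%R]%classic =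
   \int[mu]_(u in `]-oo, 0%R]) (\int[S]_x g (u + k * (c - x)))%R%:E)%E.
Proof.
pose f (p : R * measurableTypeR R) :=
  (g (p.2 + k * (c - p.1)) * \1_`]-oo, 0%R]%classic p.2)%:E.
have mf : measurable_fun setT f.
  apply/measurable_EFinP; apply: measurable_funM.
    apply: measurableT_comp; first exact: measurable_normal_pdf.
    apply: measurable_funD; first exact: measurable_snd.
    by apply: measurable_funM => //; apply: measurable_funB => //; exact: measurable_fst.
  by apply: measurableT_comp; [exact: measurable_indic|exact: measurable_snd].
have f0 p : (0 <= f p)%E by rewrite lee_fin mulr_ge0// ?normal_pdf_ge0.
transitivity (\int[S]_x \int[mu]_u f (x, u))%E.
  apply: eq_integral => x _.
  rewrite [LHS]normal_prob_shift integral_mkcond; apply: eq_integral => u _.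
  rewrite patchE /f /= indicE; case: ifPn => _ /=; first by rewrite mulr1.
  by rewrite mulr0.
rewrite (fubini_tonelli f)// [RHS]integral_mkcond; apply: eq_integral => u _.
rewrite patchE /f /= indicE; case: ifPn => _ /=; last first.
  by under eq_integral do rewrite mulr0; rewrite integral0.
under eq_integral do rewrite mulr1.
rewrite /Rintegral fineK//.
apply: integrable_fin_num => //.
apply: (@finite_measure_bounded_integrable _ _ _ _ _ (normal_peak 1)).
  apply: measurableT_comp; first exact: measurable_normal_pdf.
  by apply: measurable_funD => //; apply: measurable_funM => //; apply: measurable_funB.
move=> x; rewrite ger0_norm ?normal_pdf_ge0//.
by apply: normal_pdf_ub; exact: oner_neq0.
Qed.

Let smoothPQ (k c : R) :
  (\int[P]_x N `]-oo, (k * (c - x))%R]%classic =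
   \int[Q]_x N `]-oo, (k * (c - x))%R]%classic)%E.
Proof.
rewrite !smooth; apply: eq_integral => u _; congr EFin.
have E (x : R) : g (u + k * (c - x)) =
    normal_peak 1 * expR (- ((k * x - (u + k * c)) ^+ 2 / 2)).
  rewrite /g normal_pdfE ?oner_neq0// /normal_fun subr0 expr1n.
  have -> : u + k * (c - x) = - (k * x - (u + k * c)) by ring.
  by rewrite sqrrN mulNr.
have iE (S : probability R R) : S.-integrable setT
    (EFin \o (fun x => expR (- ((k * x - (u + k * c)) ^+ 2 / 2)))).
  apply: (@finite_measure_bounded_integrable _ _ _ _ _ 1).
    apply: measurableT_comp => //; apply: measurableT_comp => //.
    apply: measurable_funM => //; apply: measurable_funX.
    by apply: measurable_funB => //; exact: measurable_funM.
  move=> x; rewrite ger0_norm ?expR_ge0// -expR0 ler_expR oppr_le0.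
  by rewrite divr_ge0// sqr_ge0.
have I (S : probability R R) : \int[S]_x g (u + k * (c - x)) =
    normal_peak 1 * \int[S]_x expR (- ((k * x - (u + k * c)) ^+ 2 / 2)).
  rewrite -(RintegralZl _ measurableT (iE S)).
  by apply: eq_Rintegral => x _; exact: E.
by rewrite !I gauss_testPQ.
Qed.

(** The noise has standard deviation [n.+1%:R ^- 2] and the threshold [a] is
    moved to the right by the larger amount [n.+1%:R^-1].  Thus the smoothed
    indicator tends to 1 also at the point [a] itself, where without the
    translation it would tend to one half. *)
Let smooth_cvg (S : probability R R) (a : R) :
  \int[S]_x dfun N (n.+1%:R ^+ 2 * (a + n.+1%:R^-1 - x)) @[n --> \oo] -->
  dfun S a.
Proof.
have -> : dfun S a = \int[S]_x \1_`]-oo, a]%classic x.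
  by rewrite /Rintegral integral_indic// setIT.
apply: (@Rintegral_dominated_cvg _ R _ S _ _ (fun=> 1)).
- move=> n; apply: measurableT_comp; first exact: measurable_dfun.
  by apply: measurable_funM => //; apply: measurable_funB.
- exact: measurable_indic.
- apply: aeW => x.
  have E (n : nat) : n.+1%:R ^+ 2 * (a + n.+1%:R^-1 - x) =
      n.+1%:R * (1 + n.+1%:R * (a - x)) :> R.
    have : n.+1%:R != 0 :> R by rewrite pnatr_eq0.
    by move: (n.+1%:R : R) => m m0; field.
  under eq_fun do rewrite E.
  rewrite indicE; have [xa|ax] := leP x a.
  + rewrite mem_set/= ?in_itv//=.
    apply: (cvg_comp _ _ _ (dfun_cvg1 N)).
    apply/cvgryPge => A; near=> n.
    have n1 : A <= n.+1%:R.
      near: n; exists (Num.truncn `|A|) => // n /= An.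
      rewrite (le_trans (ler_norm _))// ltW// (lt_le_trans (truncnS_gt _))//.
      by rewrite ler_nat.
    rewrite (le_trans n1)// ler_peMr// lerDl mulr_ge0// subr_ge0.
    exact: xa.
  + rewrite memNset/=; last by rewrite in_itv/= leNgt ax.
    apply: (cvg_comp _ _ _ (dfun_cvg0 N)).
    apply/cvgrNyPle => A; near=> n.
    have n1 : - A <= n.+1%:R.
      near: n; exists (Num.truncn `|A|) => // n /= An.
      rewrite (le_trans (ler_norm _))// normrN ltW// (lt_le_trans (truncnS_gt _))//.
      by rewrite ler_nat.
    have n2 : 2 / (x - a) <= n.+1%:R.
      near: n; exists (Num.truncn (2 / (x - a))) => // n /= An.
      by rewrite ltW// (lt_le_trans (truncnS_gt _))// ler_nat.
    move: n2; rewrite ler_pdivrMr ?subr_gt0// => n2.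
    have n0 : (0 : R) <= n.+1%:R by [].
    move: n0 n1 n2; set m := n.+1%:R => m0 m1 m2; nra.
- apply: (@finite_measure_bounded_integrable _ _ _ S (fun=> 1) 1) => // x.
  by rewrite normr1.
- by move=> n x; rewrite ger0_norm ?dfun_ge0// dfun_le1.
Unshelve. all: by end_near. Qed.

(** After adding an independent Gaussian variable of small variance, the
    distribution functions become averages of the integrals in [gauss_test],
    which are the same for [P] and [Q]; then the variance tends to zero. *)
Lemma eq_charfun_prob A : measurable A -> P A = Q A.
Proof.
apply: eq_dfun_prob => a.
have E (S : probability R R) (k c : R) :
  \int[S]_x dfun N (k * (c - x)) = fine (\int[S]_x N `]-oo, (k * (c - x))%R]%classic)%E.
  by rewrite /Rintegral; congr fine; apply: eq_integral => x _; rewrite EFin_dfun.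
have cP := @smooth_cvg P a; have cQ := @smooth_cvg Q a.
move: cP; under eq_fun do rewrite E smoothPQ -E.
by move=> cP; exact: (cvg_unique _ cP cQ).
Qed.

End charfun_unique.

(** * Laws with a real characteristic function *)

Section symmetric_charfun.
Context (R : realType).
Implicit Types P Q : probability R R.

(** All the laws on the line that occur below are symmetric, so that their
    characteristic functions are real. *)
Definition symmetric_charfun P (psi : R -> R) := forall z : R,
  \int[P]_x cos (z * x) = psi z /\ \int[P]_x sin (z * x) = 0.

Lemma symmetric_charfun_unique P Q psi : symmetric_charfun P psi ->
  symmetric_charfun Q psi -> forall A, measurable A -> P A = Q A.
Proof.
move=> hP hQ; apply: eq_charfun_prob => z.
  by rewrite (hP z).1 (hQ z).1.
by rewrite (hP z).2 (hQ z).2.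
Qed.

Lemma measurable_addR : measurable_fun setT (fun p : R * R => p.1 + p.2).
Proof. by apply: measurable_funD; [exact: measurable_fst|exact: measurable_snd]. Qed.

Lemma measurable_subR : measurable_fun setT (fun p : R * R => p.1 - p.2).
Proof. by apply: measurable_funB; [exact: measurable_fst|exact: measurable_snd]. Qed.

Definition convR P Q : probability R R :=
  image_prob (product_prob P Q) measurable_addR.

Definition convNR P Q : probability R R :=
  image_prob (product_prob P Q) measurable_subR.

Section product_charfun.
Variables (P Q : probability R R) (f g : R -> R).
Hypotheses (Pf : symmetric_charfun P f) (Qg : symmetric_charfun Q g).

Let mM (z : R) : measurable_fun setT (fun x : R => z * x).
Proof. exact: measurable_funM. Qed.

(** The sign [e] treats sums and differences at once. *)
Let int_cosD (e z : R) :
  \int[product_prob P Q]_p cos (z * p.1 + e * (z * p.2)) = f z * g (e * z).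
Proof.
have mf : measurable_fun setT (fun p : R * R => cos (z * p.1 + e * (z * p.2))).
  apply: measurableT_comp.
    by apply: continuous_measurable_fun; exact: continuous_cos.
  by apply: measurable_funD; do ?apply: measurable_funM => //.
rewrite -(bounded_fubini1 (M := 1) _ _ mf); last by move=> p; exact: cos_max.
transitivity (\int[P]_x (cos (z * x) * g (e * z))); last first.
  by rewrite RintegralZr ?(Pf z).1//; exact: integrable_cosM.
apply: eq_Rintegral => x _ /=.
have iC := integrableZl measurableT (cos (z * x)) (integrable_cosM Q (mM (e * z))).
have iS := integrableZl measurableT (sin (z * x)) (integrable_sinM Q (mM (e * z))).
transitivity (\int[Q]_y (cos (z * x) * cos (e * z * y) - sin (z * x) * sin (e * z * y))).
  by apply: eq_Rintegral => y _; rewrite cosD mulrA.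
rewrite RintegralB// RintegralZl//; last exact: integrable_cosM.
rewrite RintegralZl//; last exact: integrable_sinM.
by rewrite (Qg _).1 (Qg _).2 mulr0 subr0.
Qed.

Let int_sinD (e z : R) :
  \int[product_prob P Q]_p sin (z * p.1 + e * (z * p.2)) = 0.
Proof.
have mf : measurable_fun setT (fun p : R * R => sin (z * p.1 + e * (z * p.2))).
  apply: measurableT_comp.
    by apply: continuous_measurable_fun; exact: continuous_sin.
  by apply: measurable_funD; do ?apply: measurable_funM => //.
rewrite -(bounded_fubini1 (M := 1) _ _ mf); last by move=> p; exact: sin_max.
transitivity (\int[P]_x (sin (z * x) * g (e * z))); last first.
  by rewrite RintegralZr ?(Pf z).2 ?mul0r//; exact: integrable_sinM.
apply: eq_Rintegral => x _ /=.
have iC := integrableZl measurableT (sin (z * x)) (integrable_cosM Q (mM (e * z))).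
have iS := integrableZl measurableT (cos (z * x)) (integrable_sinM Q (mM (e * z))).
transitivity (\int[Q]_y (sin (z * x) * cos (e * z * y) + cos (z * x) * sin (e * z * y))).
  by apply: eq_Rintegral => y _; rewrite sinD mulrA.
rewrite RintegralD// RintegralZl//; last exact: integrable_cosM.
rewrite RintegralZl//; last exact: integrable_sinM.
by rewrite (Qg _).1 (Qg _).2 mulr0 addr0.
Qed.

Lemma symmetric_charfun_convR : symmetric_charfun (convR P Q) (fun z => f z * g z).
Proof.
move=> z; split.
  rewrite (@Rintegral_image _ _ _ _ _ _ _ _ _ 1); last 2 first.
    exact: measurable_cosM.
    by move=> y; exact: cos_max.
  rewrite -[in g z](mul1r z) -int_cosD; apply: eq_Rintegral => p _.
  by rewrite mul1r mulrDr.
rewrite (@Rintegral_image _ _ _ _ _ _ _ _ _ 1); last 2 first.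
  exact: measurable_sinM.
  by move=> y; exact: sin_max.
rewrite -(int_sinD 1 z); apply: eq_Rintegral => p _.
by rewrite mul1r mulrDr.
Qed.

Lemma symmetric_charfun_even z : g (- z) = g z.
Proof.
rewrite -(Qg z).1 -(Qg (- z)).1; apply: eq_Rintegral => x _.
by rewrite mulNr cosN.
Qed.

Lemma symmetric_charfun_convNR : symmetric_charfun (convNR P Q) (fun z => f z * g z).
Proof.
move=> z; split.
  rewrite (@Rintegral_image _ _ _ _ _ _ _ _ _ 1); last 2 first.
    exact: measurable_cosM.
    by move=> y; exact: cos_max.
  rewrite -(symmetric_charfun_even z) -mulN1r -int_cosD; apply: eq_Rintegral => p _.
  by rewrite mulN1r mulrBr.
rewrite (@Rintegral_image _ _ _ _ _ _ _ _ _ 1); last 2 first.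
  exact: measurable_sinM.
  by move=> y; exact: sin_max.
rewrite -(int_sinD (-1) z); apply: eq_Rintegral => p _.
by rewrite mulN1r mulrBr.
Qed.

End product_charfun.

Lemma symmetric_charfun_dirac0 : symmetric_charfun (\d_(0 : R)) (fun=> 1).
Proof.
move=> z; rewrite /Rintegral !integral_dirac//.
- by rewrite diracT !mul1e mulr0 cos0 sin0.
- by apply/measurable_EFinP; exact: measurable_sinM.
- by apply/measurable_EFinP; exact: measurable_cosM.
Qed.

Definition convR_pow P n : probability R R := iter n (convR P) \d_(0 : R).

Lemma symmetric_charfun_convR_pow P (theta : R -> R) n :
  symmetric_charfun P theta ->
  symmetric_charfun (convR_pow P n) (fun z => theta z ^+ n).
Proof.
move=> PC; elim: n => [|n IH]; first exact: symmetric_charfun_dirac0.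
have := symmetric_charfun_convR PC IH.
by move=> + z => /(_ z); rewrite -exprS.
Qed.

(** Given the second summand, the sum takes a prescribed value only if the
    first one does. *)
Lemma convR_atomless P Q : (forall x, P [set x] = 0%E) ->
  forall x, convR P Q [set x] = 0%E.
Proof.
move=> P0 x; rewrite image_probE.
have mA : measurable ((fun p : R * R => p.1 + p.2) @^-1` [set x]).
  by rewrite -[X in measurable X]setTI; exact: measurable_addR.
rewrite /product_prob/= -/(product_measure1 _ _ _).
transitivity ((P \x^ Q)%E ((fun p : R * R => p.1 + p.2) @^-1` [set x])).
  apply: product_measure_unique => // B C mB mC.
  exact: product_measure2E.
rewrite /product_measure2; apply: integral0_eq => y _ /=.
rewrite -(P0 (x - y)); congr (P _); apply/seteqP; split => z /=.
  by rewrite /ysection/= inE/= => <-; rewrite addrK.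
by move=> ->; rewrite /ysection/= inE/= subrK.
Qed.

End symmetric_charfun.

Section odd_integrals.
Context (R : realType).

Let measurable_negR : measurable_fun setT (fun x : R => - x).
Proof. exact: measurable_funN. Qed.

Lemma Rintegral_odd (P : probability R R) (f : R -> R) (M : R) :
  (forall A : set R, measurable A -> P ((fun t => - t) @^-1` A) = P A) ->
  measurable_fun setT f -> (forall x, `|f x| <= M) ->
  (forall x, f (- x) = - f x) -> \int[P]_x f x = 0.
Proof.
move=> PN mf fM fN.
have intf : P.-integrable setT (EFin \o f).
  exact: finite_measure_bounded_integrable fM.
have E1 : \int[P]_x (- f x) = - \int[P]_x f x.
  transitivity (\int[P]_x (-1 * f x)); last by rewrite RintegralZl// mulN1r.
  by apply: eq_Rintegral => x _; rewrite mulN1r.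
have E2 : \int[image_prob P measurable_negR]_x f x = \int[P]_x (- f x).
  by rewrite (Rintegral_image _ _ mf fM); apply: eq_Rintegral => x _; rewrite fN.
have E3 : \int[image_prob P measurable_negR]_x f x = \int[P]_x f x.
  rewrite /Rintegral; congr fine; apply: eq_measure_integral => A mA _.
  exact: PN.
by move: E1; rewrite -E2 E3; lra.
Qed.

(** The density is even and Lebesgue measure is invariant under reflection. *)
Lemma gaussian_sym (s : R) (A : set R) : s != 0 -> measurable A ->
  gaussian s ((fun t => - t) @^-1` A) = gaussian s A.
Proof.
move=> s0 mA; rewrite !image_probE /normal_prob.
have mNA : measurable ((fun t : R => - t) @^-1` A).
  by rewrite -[X in measurable X]setTI; exact: measurable_negR.
transitivity (\int[pushforward (@lebesgue_measure R)
    (-%R : measurableTypeR R -> measurableTypeR R)]_(x in A) (normal_pdf 0 s x)%:E)%E.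
  rewrite ge0_integral_pushforward//=.
  - apply: eq_integral => x _; congr EFin.
    by rewrite !normal_pdfE// /normal_fun !subr0 sqrrN.
  - by apply/measurable_EFinP/measurable_funTS; exact: measurable_normal_pdf.
  - by move=> x _; rewrite lee_fin normal_pdf_ge0.
by apply: eq_measure_integral => B mB _; exact: lebesgue_measureN.
Qed.

Lemma symmetric_charfun_gaussian (s : R) : s != 0 ->
  symmetric_charfun (gaussian s) (fun z => expR (- (s ^+ 2 * z ^+ 2 / 2))).
Proof.
move=> s0 z; split; first exact: gaussian_cos.
apply: (@Rintegral_odd _ _ 1).
- by move=> A mA; exact: gaussian_sym.
- exact: measurable_sinM.
- by move=> x; exact: sin_max.
- by move=> x; rewrite mulrN sinN.
Qed.

Lemma gaussian_atomless (s x : R) : gaussian s [set x] = 0%E.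
Proof.
have /null_content_dominatesP := normal_prob_dominates 0 s.
by apply => //; exact: lebesgue_measure_set1.
Qed.

End odd_integrals.

(** * Gaussian variables plus compound Poisson sums *)

Lemma integral_cst1D d (T : measurableType d) (R : realType)
    (mu : {finite_measure set T -> \bar R}) (f : T -> R) (m : R) :
  mu setT = m%:E -> mu.-integrable setT (EFin \o f) ->
  (\int[mu]_t (1%:E + (f t)%:E) = (m + \int[mu]_t f t)%R%:E)%E.
Proof.
move=> mum fi; rewrite integralD//; last exact: finite_measure_integrable_cst.
rewrite integral_cst// mul1e EFinD /Rintegral fineK; last exact: integrable_fin_num.
by congr (_ + _)%E.
Qed.

Section poisson_mixture.
Context d (T : measurableType d) (R : realType).
Variables (c : {nonneg R}) (K : nat -> probability T R).

Let w (m : nat) : R := expR (- c%:num) * exp_coeff c%:num m.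

Let w_ge0 m : 0 <= w m.
Proof. by rewrite mulr_ge0 ?expR_ge0//; apply: exp_coeff_ge0. Qed.

Let w_series (x : R) :
  series (fun m => w m * x ^+ m) @ \oo --> expR (c%:num * (x - 1)).
Proof.
have -> : series (fun m => w m * x ^+ m) =
    (fun n => expR (- c%:num) * series (exp_coeff (c%:num * x)) n).
  apply/funext => n; rewrite /series/= mulr_sumr; apply: eq_bigr => i _.
  by rewrite /w /exp_coeff /= exprMn; ring.
have -> : expR (c%:num * (x - 1)) = expR (- c%:num) * expR (c%:num * x).
  by rewrite -expRD; congr expR; ring.
by apply: cvgMr; exact: is_cvg_series_exp_coeff.
Qed.

Let nneg_seriesE (a : nat -> R) (l : R) : (forall m, 0 <= a m) ->
  series a @ \oo --> l -> (\sum_(m <oo) (a m)%:E)%E = l%:E.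
Proof.
move=> a0 al; apply/cvg_lim => //.
under eq_fun do rewrite sumEFin.
by apply: cvg_EFin; [exact: nearW|exact: al].
Qed.

(** The law of a variable drawn from [K m], where [m] is random with the
    Poisson law of parameter [c]. *)
Definition poisson_mixture : set T -> \bar R :=
  mseries (fun m => mscale (NngNum (w_ge0 m)) (K m)) 0.

HB.instance Definition _ := Measure.on poisson_mixture.

Let poisson_mixtureT : poisson_mixture setT = 1%E.
Proof.
rewrite /poisson_mixture /mseries.
transitivity (\sum_(m <oo) (w m * 1 ^+ m)%:E)%E.
  apply: eq_eseriesr => m _; rewrite expr1n mulr1.
  have KT : K m setT = 1%E by exact: probability_setT.
  by change ((w m)%:E * K m setT = (w m)%:E)%E; rewrite KT mule1.
apply: nneg_seriesE => [m|]; first by rewrite expr1n mulr1.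
by have := @w_series 1; rewrite subrr mulr0 expR0.
Qed.

HB.instance Definition _ := Measure_isProbability.Build _ _ _
  poisson_mixture poisson_mixtureT.

(** Integrals against a series of measures are available for nonnegative
    functions, whence the detour through [1 + f]. *)
Let Rintegral_mixture (f : T -> R) (I_ : nat -> R) (l : R) :
  measurable_fun setT f -> (forall t, `|f t| <= 1) ->
  (forall m, \int[K m]_t f t = I_ m) ->
  series (fun m => w m * I_ m) @ \oo --> l ->
  \int[poisson_mixture]_t f t = l.
Proof.
move=> mf f1 fK wl.
have f0 t : 0 <= 1 + f t by have := f1 t; rewrite ler_norml => /andP[+ _]; lra.
have m1f : measurable_fun setT (fun t => (1 + f t)%:E).
  by apply/measurable_EFinP; exact: measurable_funD.
have I (P : probability T R) :
    (\int[P]_t (1 + f t)%:E)%E = (1 + \int[P]_t f t)%:E.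
  have if1 : P.-integrable setT (EFin \o f).
    exact: finite_measure_bounded_integrable f1.
  rewrite -(integral_cst1D (probability_setT P) if1).
  by apply: eq_integral => t _; rewrite EFinD.
have : (\int[poisson_mixture]_t (1 + f t)%:E)%E = (1 + l)%:E.
  rewrite ge0_integral_measure_series//; last by move=> t _; rewrite lee_fin.
  transitivity (\sum_(m <oo) (w m * (1 + I_ m))%:E)%E.
    apply: eq_eseriesr => m _.
    rewrite ge0_integral_mscale//; last by move=> t _; rewrite lee_fin.
    by rewrite I fK EFinM.
  apply: nneg_seriesE.
    move=> m; rewrite -fK mulr_ge0// -lee_fin -I.
    by apply: integral_ge0 => t _; rewrite lee_fin.
  have -> : series (fun m => w m * (1 + I_ m)) =
      series (fun m => w m * 1 ^+ m) + series (fun m => w m * I_ m).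
    apply/funext => n; rewrite /series/= !fctE -big_split/=.
    by apply: eq_bigr => m _; rewrite expr1n mulrDr.
  apply: cvgD; last exact: wl.
  by rewrite -[X in _ --> X]expR0 -[X in expR X](mulr0 c%:num) -[X in _ * X](subrr 1); exact: w_series.
by rewrite I => -[] /addrI.
Qed.

(** The right-hand side is the generating function of the Poisson law at
    [x]. *)
Lemma Rintegral_poisson_mixture_exp (f : T -> R) (x : R) :
  measurable_fun setT f -> (forall t, `|f t| <= 1) ->
  (forall m, \int[K m]_t f t = x ^+ m) ->
  \int[poisson_mixture]_t f t = expR (c%:num * (x - 1)).
Proof. by move=> mf f1 fK; apply: (Rintegral_mixture mf f1 fK). Qed.

Lemma Rintegral_poisson_mixture0 (f : T -> R) :
  measurable_fun setT f -> (forall t, `|f t| <= 1) ->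
  (forall m, \int[K m]_t f t = 0) -> \int[poisson_mixture]_t f t = 0.
Proof.
move=> mf f1 fK; apply: (Rintegral_mixture mf f1 fK).
rewrite (_ : series _ = cst 0); first exact: cvg_cst.
by apply/funext => n; rewrite /series/= big1// => m _; rewrite mulr0.
Qed.

End poisson_mixture.

Section gauss_poisson.
Context (R : realType).
Variable lambda : {finite_measure set (measurableTypeR R) -> \bar R}.
Hypothesis lambda_sym : symmetric_measure lambda.

Let measurable_idR : measurable_fun setT (fun x : measurableTypeR R => x : R).
Proof. exact: measurable_id. Qed.

(** The law of a single jump.  For [lambda = 0] the normalization returns its
    second argument; a symmetric law is chosen there, so that [jump_sym] holds
    in all cases. *)
Let jumpT : probability (measurableTypeR R) R :=
  mnormalize lambda (normal_prob 0 1).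

Let jump : probability R R := image_prob jumpT measurable_idR.

Let jumpE (A : set R) : jump A = mnormalize lambda (normal_prob 0 1) A.
Proof. by []. Qed.

Let mass : R := fine (lambda setT).

Let mass_ge0 : 0 <= mass. Proof. exact: fine_ge0. Qed.

Let jump_massE A : measurable A -> ((mass)%:E * jump A)%E = lambda A.
Proof.
move=> mA; rewrite jumpE /mnormalize.
have lfin : lambda setT \is a fin_num by exact: fin_num_measure.
case: ifPn => [/orP[/eqP l0|/eqP ly]|]; last first.
- rewrite negb_or => /andP[l0 ly].
  change (mass%:E * (lambda A * (mass^-1)%R%:E) = lambda A)%E.
  rewrite muleCA -EFinM mulfV ?mule1//.
  apply: contra l0 => /eqP l0; apply/eqP.
  by apply: etrans (esym (fineK lfin)) _; congr EFin; exact: l0.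
- by rewrite ly in lfin.
- have m0 : mass = 0 by exact: (congr1 fine l0).
  rewrite m0 mul0e; apply/esym/eqP; rewrite eq_le measure_ge0 andbT.
  have : (lambda A <= lambda setT)%E by apply: le_measure; rewrite ?inE.
  by move=> /le_trans; apply; move: l0 => ->.
Qed.

(** As above, [1 + f] is used because it is nonnegative. *)
Let jump_mass_integral (f : R -> R) : measurable_fun setT f ->
  (forall x, `|f x| <= 1) -> mass * \int[jump]_x f x = \int[lambda]_x f x.
Proof.
move=> mf f1.
have f0 t : 0 <= 1 + f t by have := f1 t; rewrite ler_norml => /andP[+ _]; lra.
have mf' : measurable_fun [set: measurableTypeR R] f by exact: mf.
have m1f : measurable_fun setT (fun t => 1%:E + (f t)%:E)%E.
  by apply: emeasurable_funD => //; exact/measurable_EFinP.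
have ifj : jump.-integrable setT (EFin \o f).
  exact: finite_measure_bounded_integrable f1.
have ifl : lambda.-integrable setT (EFin \o f).
  exact: (finite_measure_bounded_integrable lambda mf' f1).
have : (mass%:E * \int[jump]_t (1%:E + (f t)%:E) =
    \int[lambda]_t (1%:E + (f t)%:E))%E.
  rewrite [in LHS]ge0_integral_image//.
  rewrite -[mass]/((NngNum mass_ge0)%:num) -ge0_integral_mscale//; last first.
    by move=> t _; rewrite -EFinD lee_fin.
  by apply: eq_measure_integral => A mA _; exact: jump_massE.
rewrite (integral_cst1D (probability_setT jump) ifj).
rewrite (integral_cst1D (esym (fineK (fin_num_measure lambda _ measurableT))) ifl).
by rewrite -EFinM mulrDr mulr1 => -[] /addrI.
Qed.

Let jump_sym_mass (A : set R) : measurable A -> mass != 0 -> jump ((fun t => - t) @^-1` A) = jump A.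
Proof.
move=> mA m0.
have mNA : measurable ((fun t : R => - t) @^-1` A).
  by rewrite -[X in measurable X]setTI; exact: measurable_funN.
have : (mass%:E * jump ((fun t : R => - t)%R @^-1` A) = mass%:E * jump A)%E.
  rewrite !jump_massE// [RHS]lambda_sym//; congr (lambda _).
  apply/seteqP; split => x /=.
    by move=> Ax; exists (- x); rewrite ?opprK.
  by move=> [y /= Ay <-]; rewrite opprK.
have fj B : measurable B -> jump B \is a fin_num.
  by move=> mB; exact: fin_num_measure.
rewrite -(fineK (fj _ mA)) -(fineK (fj _ mNA)) -!EFinM => -[] /(mulfI m0) ->.
by [].
Qed.

Let jump_sym (A : set R) : measurable A -> jump ((fun t => - t) @^-1` A) = jump A.
Proof.
move=> mA; have [m0|] := eqVneq mass 0; last exact: jump_sym_mass.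
have l0 : lambda setT = 0%E.
  by rewrite -(fineK (fin_num_measure lambda _ measurableT)) -/mass m0.
have jE B : jump B = gaussian 1 B.
  rewrite jumpE /mnormalize; case: ifPn => // /negP[].
  by apply/orP; left; apply/eqP; exact: l0.
by rewrite !jE gaussian_sym ?oner_neq0.
Qed.

(** This removes the sines and the truncation term from the
    Levy-Khintchine exponent. *)
Lemma Rintegral_symmetric_odd (f : R -> R) (M : R) : measurable_fun setT f ->
  (forall x, `|f x| <= M) -> (forall x, f (- x) = - f x) ->
  \int[lambda]_x f x = 0.
Proof.
move=> mf fM fN.
(* dividing by [c] brings [f] below 1, and [c] is positive even if [M] is 0 *)
pose c := `|M| + 1.
have c0 : 0 < c by rewrite ltr_wpDl.
have mg : measurable_fun setT (fun x => c^-1 * f x) by exact: measurable_funM.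
have g1 x : `|c^-1 * f x| <= 1.
  rewrite normrM gtr0_norm ?invr_gt0// mulrC ler_pdivrMr// mul1r.
  by rewrite (le_trans (fM x))// (le_trans (ler_norm M))// lerDl.
have : \int[lambda]_x (c^-1 * f x) = 0.
  rewrite -jump_mass_integral// (@Rintegral_odd _ _ _ 1) ?mulr0//.
  by move=> x; rewrite fN mulrN.
rewrite RintegralZl//; last first.
  by apply: (finite_measure_bounded_integrable lambda _ fM); exact: mf.
by move=> /eqP; rewrite mulf_eq0 invr_eq0 gt_eqF//= => /eqP.
Qed.

Let jump_charfun :
  symmetric_charfun jump (fun z => \int[jump]_x cos (z * x)).
Proof.
move=> z; split => //; apply: (@Rintegral_odd _ _ _ 1).
- exact: jump_sym.
- exact: measurable_sinM.
- by move=> x; exact: sin_max.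
- by move=> x; rewrite mulrN sinN.
Qed.

(** The law of a Gaussian variable of variance [tau ^+ 2] plus an independent
    sum of a Poisson number, of parameter [a%:num * mass], of independent jumps
    distributed according to the normalization of [lambda].  The Gaussian part
    makes it atomless. *)
Lemma gauss_poisson_law (tau : R) (a : {nonneg R}) : tau != 0 ->
  exists rho : probability R R, (forall x, rho [set x] = 0%E) /\
    symmetric_charfun rho (fun z => expR (- (tau ^+ 2 * z ^+ 2 / 2) +
      a%:num * \int[lambda]_t (cos (z * t) - 1))).
Proof.
move=> tau0.
have a0 : 0 <= a%:num by [].
pose c : {nonneg R} := NngNum (mulr_ge0 a0 mass_ge0).
pose N : probability R R := poisson_mixture c (convR_pow jump).
exists (convR (gaussian tau) N); split.
  by apply: convR_atomless => x; exact: gaussian_atomless.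
have NC : symmetric_charfun N (fun z => expR (c%:num * (\int[jump]_x cos (z * x) - 1))).
  move=> z; split.
    apply: Rintegral_poisson_mixture_exp.
    - exact: measurable_cosM.
    - by move=> x; exact: cos_max.
    - by move=> m; rewrite (symmetric_charfun_convR_pow m jump_charfun z).1.
  apply: Rintegral_poisson_mixture0.
  - exact: measurable_sinM.
  - by move=> x; exact: sin_max.
  - by move=> m; rewrite (symmetric_charfun_convR_pow m jump_charfun z).2.
have := symmetric_charfun_convR (symmetric_charfun_gaussian tau0) NC.
move=> + z => /(_ z); rewrite -expRD.
suff -> : c%:num * (\int[jump]_x cos (z * x) - 1) =
  a%:num * \int[lambda]_t (cos (z * t) - 1) by [].
rewrite /= -mulrA; congr (_ * _); rewrite mulrBr mulr1 jump_mass_integral//.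
- rewrite RintegralB//; last 2 first.
  + exact: (@integrable_cosM R _ _ lambda _ (measurable_funM (measurable_cst z) (@measurable_id _ _ setT))).
  + exact: finite_measure_integrable_cst.
  by rewrite Rintegral_cst// mul1r.
- exact: measurable_cosM.
- by move=> x; exact: cos_max.
Qed.

End gauss_poisson.

(** * The quantile transform *)

Section quantile_transform.
Context (R : realType).
Implicit Types P q rho : probability R R.

Lemma dfun_gt P (c : R) : c < 1 -> exists t, c < dfun P t.
Proof.
move=> c1; have := cvgr_gt _ (@dfun_cvg1 _ P) _ c1.
move=> [M [_ MP]]; exists (M + 1); apply: MP.
by rewrite ltrDl.
Qed.

Lemma dfun_lt P (c : R) : 0 < c -> exists t, dfun P t < c.
Proof.
move=> c0; have := cvgr_lt _ (@dfun_cvg0 _ P) _ c0.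
move=> [M [_ MP]]; exists (M - 1); apply: MP.
by rewrite ltrBlDr ltrDl.
Qed.

Lemma dfun_ge_right P (a c : R) : (forall x, a < x -> c <= dfun P x) ->
  c <= dfun P a.
Proof.
move=> ac; rewrite leNgt; apply/negP => ca.
have Fc : \forall t \near a^'+, dfun P t < c.
  exact: (cvgr_lt _ (@dfun_right_continuous _ P a) _ ca).
have : \forall t \near a^'+, dfun P t < c /\ a < t.
  by apply: filterI Fc _; exact: nbhs_right_gt.
move=> /(@filter_ex _ _ (at_right_proper_filter a))[x [Fxc ax]].
by have := le_lt_trans (ac _ ax) Fxc; rewrite ltxx.
Qed.

(** If [b] has no mass, the distribution function is left continuous at [b]. *)
Lemma dfun_le_left P (b c : R) : P [set b] = 0%E ->
  (forall x, x < b -> dfun P x <= c) -> dfun P b <= c.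
Proof.
move=> Pb bc; rewrite -lee_fin EFin_dfun.
have -> : P `]-oo, b]%classic = P `]-oo, b[%classic.
  by rewrite -(@setUitv1 _ _ -oo%O b true)// measureU0.
pose F n : set R := `]-oo, b - n.+1%:R^-1]%classic.
have UF : \bigcup_n F n = `]-oo, b[%classic.
  apply/seteqP; split => x /=.
    move=> [n _] /=; rewrite /F/= !in_itv/= => /le_lt_trans; apply.
    by rewrite ltrBlDr ltrDl invr_gt0.
  rewrite in_itv/= => xb.
  have e0 : 0 < b - x by rewrite subr_gt0.
  have [n _ /(_ n (leqnn n))] := near_infty_natSinv_lt (PosNum e0).
  by move=> /= ne; exists n => //; rewrite /F/= in_itv/= lerBrDr -lerBrDl ltW.
have : P (F n) @[n --> \oo] --> P (\bigcup_n F n).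
  apply: nondecreasing_cvg_mu.
  - by move=> n; exact: measurable_itv.
  - by rewrite UF; exact: measurable_itv.
  move=> m n mn; apply/subsetPset => x; rewrite /F/= !in_itv/= => /le_trans; apply.
  by rewrite lerB// lef_pV2 ?posrE// ler_nat.
rewrite UF => /cvg_lim <- //.
apply: lime_le; last first.
  apply: nearW => n; rewrite -EFin_dfun lee_fin bc//.
  by rewrite ltrBlDr ltrDl invr_gt0.
apply: ereal_nondecreasing_is_cvgn => m n mn; apply: le_measure.
- by rewrite inE; exact: measurable_itv.
- by rewrite inE; exact: measurable_itv.
move=> x; rewrite /F/= !in_itv/= => /le_trans; apply.
by rewrite lerB// lef_pV2 ?posrE// ler_nat.
Qed.

Section atomless.
Variable q : probability R R.
Hypothesis q_atomless : forall x, q [set x] = 0%E.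
Let F := dfun q.

Let measurable_dfun_le c : measurable [set x | F x <= c].
Proof.
rewrite -[X in measurable X]setTI.
have -> : [set x | F x <= c] = F @^-1` `]-oo, c]%classic.
  by apply/seteqP; split => x /=; rewrite in_itv.
exact: measurable_dfun.
Qed.

(** An atomless law becomes uniform on the unit interval when transported by
    its own distribution function [F]: the set is a half-line ending at its
    supremum [b], and [F b = c] because [F] is continuous. *)
Lemma dfun_uniform (c : R) : 0 <= c <= 1 -> q [set x | F x <= c] = c%:E.
Proof.
move=> /andP[c0]; rewrite le_eqVlt => /predU1P[->|c1].
  rewrite -(probability_setT q); congr (q _); apply/seteqP; split => x // _ /=.
  exact: dfun_le1.
have [t ct] := dfun_gt q c1.
have [[s Fs]|noF] := pselect (exists s, F s <= c); last first.
  have -> : [set x | F x <= c] = set0.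
    by rewrite -subset0 => x /= Fx; apply: noF; exists x.
  rewrite measure0; congr EFin; apply/eqP; rewrite eq_le c0/= leNgt.
  apply/negP => c0'; have [s Fs] := dfun_lt q c0'.
  by apply: noF; exists s; exact: ltW.
pose D := [set x | F x <= c].
have ubD : ubound D t.
  move=> x /= Fx; rewrite leNgt; apply/negP => tx.
  have := le_trans (dfun_nondecreasing q (ltW tx)) Fx.
  by rewrite leNgt ct.
have supD : has_sup D by split; [exists s|exists t].
pose b := sup D.
have Fb_le x : x < b -> F x <= c.
  move=> xb; have [y /= Fy xy] := sup_gt supD.1 xb.
  exact: le_trans (dfun_nondecreasing q (ltW xy)) Fy.
have Fb_ge x : b < x -> c <= F x.
  move=> bx; rewrite leNgt; apply/negP => Fx.
  have := ub_le_sup supD.2 (ltW Fx : D x); rewrite leNgt.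
  by rewrite bx.
have FbE : F b = c.
  by apply/eqP; rewrite eq_le dfun_le_left// dfun_ge_right.
have -> : [set x | F x <= c] = `]-oo, b]%classic.
  apply/seteqP; split => x /=; rewrite in_itv/=; first exact: ub_le_sup supD.2 _.
  by move=> xb; rewrite -FbE; exact: dfun_nondecreasing.
by rewrite -EFin_dfun -FbE.
Qed.

Let range01 := [set x | 0 < F x < 1].

Let measurable_range01 : measurable range01.
Proof.
have -> : range01 = F @^-1` `]0, 1[%classic.
  by apply/seteqP; split => x /=; rewrite in_itv.
by rewrite -[X in measurable X]setTI; exact: measurable_dfun.
Qed.

Let q_range01C : q (~` range01) = 0%E.
Proof.
have -> : ~` range01 = [set x | F x <= 0] `|` ~` [set x | F x < 1].
  apply/seteqP; split => x /=.
    move=> /negP; rewrite negb_and -!leNgt => /orP[]; first by left.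
    by move=> F1; right; apply/negP; rewrite -leNgt.
  by move=> [Fx|/negP]; [|rewrite -leNgt => Fx]; apply/negP; rewrite negb_and -!leNgt Fx// orbT.
have mlt : measurable [set x | F x < 1].
  have -> : [set x | F x < 1] = F @^-1` `]-oo, 1[%classic.
    by apply/seteqP; split => x /=; rewrite in_itv.
  by rewrite -[X in measurable X]setTI; exact: measurable_dfun.
have N1 : q (~` [set x | F x < 1]) = 0%E.
  rewrite probability_setC//.
  suff -> : q [set x | F x < 1] = 1%E by rewrite subee.
  apply/eqP; rewrite eq_le probability_le1//=.
  apply/lee_addgt0Pr => e e0.
  have [e1|e1] := leP 1 e.
    by rewrite -[leLHS]add0e leeD// lee_fin.
  rewrite -leeBlDr// -EFinB -(@dfun_uniform (1 - e)); last first.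
    by rewrite subr_ge0 ltW//= lerBlDr lerDl ltW.
  apply: le_measure; rewrite ?inE//.
  by move=> x /= /le_lt_trans; apply; rewrite ltrBlDr ltrDl.
rewrite measureU0//; first by apply: dfun_uniform; rewrite lexx ler01.
exact: measurableC.
Qed.

(** [h] is the distribution function [F] of [q] followed by the quantile
    function of [rho].  The equivalence of [h x <= t] with [F x <= G t] reduces
    the claim to [dfun_uniform]. *)
Lemma quantile_transform rho : exists h : R -> R,
  measurable_fun setT h /\ forall A, measurable A -> q (h @^-1` A) = rho A.
Proof.
pose G := dfun rho.
pose S x := [set t | F x <= G t].
(* where [F x] is 0 or 1, the infimum may be that of an unbounded or empty set *)
pose h x := if (0 < F x < 1) then inf (S x) else 0.
have hE x t : range01 x -> (h x <= t) = (F x <= G t).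
  move=> x01; rewrite /h x01; case/andP: x01 => F0 F1.
  have [u Fu] := dfun_gt rho F1; have [l Fl] := dfun_lt rho F0.
  have infS : has_inf (S x).
    split; first by exists u; exact: ltW.
    exists l => y /= Fy; rewrite leNgt; apply/negP => yl.
    have := le_trans Fy (dfun_nondecreasing rho (ltW yl)).
    by rewrite leNgt Fl.
  apply/idP/idP => [|FG]; last exact: ge_inf infS.2 _ _.
  move=> infSt; apply: dfun_ge_right => y ty.
  have [z /= Fz zy] := inf_lt infS.1 (le_lt_trans infSt ty).
  exact: le_trans Fz (dfun_nondecreasing rho (ltW zy)).
have pre t : h @^-1` `]-oo, t]%classic = (range01 `&` [set x | F x <= G t]) `|`
    (~` range01 `&` [set x | 0 <= t]).
  apply/seteqP; split => x /=; rewrite in_itv/=.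
    have [x01 ht|x01] := boolP (0 < F x < 1); first by left; rewrite -hE.
    by rewrite /h (negbTE x01) => t0; right; split => //; exact/negP.
  move=> [[x01 FG]|[/negP x01 t0]]; first by rewrite hE.
  by rewrite /h (negbTE x01).
have mt (t : R) : measurable [set x : R | 0 <= t].
  case: (0 <= t).
    have -> : [set x : R | true] = setT by apply/seteqP.
    exact: measurableT.
  have -> : [set x : R | false] = set0 by rewrite -subset0 => x.
  exact: measurable0.
have mh : measurable_fun setT h.
  apply: (measurability _ (RGenOInfty.measurableE R)) => // _ [_ [t ->] <-].
  rewrite setTI -[X in measurable X]setCK; apply: measurableC.
  have -> : ~` (h @^-1` `]t, +oo[%classic) = h @^-1` `]-oo, t]%classic.
    by apply/seteqP; split => x /=; rewrite !in_itv/= andbT leNgt => /negP.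
  rewrite pre; by apply: measurableU; apply: measurableI => //; exact: measurableC.
exists h; split => // A mA.
rewrite -(image_probE q mh); apply: eq_dfun_prob mA => t.
apply: EFin_inj; rewrite EFin_dfun image_probE pre.
rewrite measureU0; last 3 first.
- exact: measurableI.
- by apply: measurableI => //; exact: measurableC.
- apply: (@subset_measure0 _ _ _ q _ (~` range01)) => //; last exact: measurableC.
  by apply: measurableI => //; exact: measurableC.
rewrite -(@dfun_uniform (G t)) ?dfun_ge0 ?dfun_le1//.
rewrite [RHS](_ : _ = q ([set x | F x <= G t] `&` range01 `|` [set x | F x <= G t] `&` ~` range01)).
  rewrite setIC [RHS]measureU0//; [exact: measurableI| |].
    by apply: measurableI => //; exact: measurableC.
  apply: (@subset_measure0 _ _ _ q _ (~` range01)) => //; last exact: measurableC.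
  by apply: measurableI => //; exact: measurableC.
by rewrite -setIUr setUv setIT.
Qed.

End atomless.

End quantile_transform.

(** * Laws of independent identically distributed sequences *)

Section sequence_space.
Context d (E : measurableType d).

Definition cylinder (N : nat) (A : nat -> set E) : set (nat -> E) :=
  [set a | forall k, (k < N)%N -> A k (a k)].

Definition cylinders : set (set (nat -> E)) :=
  [set C | exists N A, (forall k, measurable (A k)) /\ C = cylinder N A].

Definition seqspace := g_sigma_algebraType cylinders.

Lemma measurable_cylinder N A : (forall k, measurable (A k)) ->
  measurable (cylinder N A : set seqspace).
Proof. by move=> mA; apply: sub_sigma_algebra; exists N, A. Qed.

Lemma cylinder0 A : cylinder 0 A = setT.
Proof. by apply/seteqP; split => // a _ k. Qed.

Lemma measurable_coord k : measurable_fun setT (fun a : seqspace => a k).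
Proof.
move=> _ B mB; rewrite setTI.
have -> : (fun a : seqspace => a k) @^-1` B =
    cylinder k.+1 (fun i => if i == k then B else setT).
  apply/seteqP; split => a /=.
    by move=> Ba i _; case: eqP => // ->.
  by move=> /(_ k (ltnSn k)); rewrite eqxx.
by apply: measurable_cylinder => i; case: ifP.
Qed.

Lemma measurable_seqspace d' (T : measurableType d') (f : T -> seqspace) :
  (forall k, measurable_fun setT (fun t => f t k)) -> measurable_fun setT f.
Proof.
move=> mf; apply: (@measurability _ _ T seqspace setT f cylinders) => // _ [_ [N [A [mA ->]]] <-].
rewrite setTI.
have -> : f @^-1` cylinder N A =
    \bigcap_k (if (k < N)%N then (fun t => f t k) @^-1` A k else setT).
  apply/seteqP; split => t /=.
    by move=> fA k _; case: ifP => // kN; exact: fA.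
  by move=> + k kN => /(_ k I); rewrite kN.
apply: bigcapT_measurable => k; case: ifP => // _.
by rewrite -[X in measurable X]setTI; exact: mf.
Qed.

Lemma cylindersI : setI_closed cylinders.
Proof.
move=> _ _ [N [A [mA ->]]] [M [B [mB ->]]].
exists (maxn N M), (fun k => (if (k < N)%N then A k else setT) `&`
                             (if (k < M)%N then B k else setT)); split.
  by move=> k; apply: measurableI; case: ifP.
apply/seteqP; split => a /=.
  by move=> [aA aB] k _; split; case: ifP => // kN; [exact: aA|exact: aB].
move=> aAB; split => k kN.
  by have /(_ _)[] := aAB k; rewrite ?leq_max ?kN.
by have /(_ _)[|_] := aAB k; rewrite ?leq_max ?kN ?orbT.
Qed.

End sequence_space.

Section iid_law.
Context (R : realType).

(** The law of a sequence of independent variables of common law [q].  It is a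
    property of [Q], not a construction: the only laws that occur are images of
    the law of a given sequence. *)
Definition iid_law d (E : measurableType d) (q : probability E R)
    (Q : probability (seqspace E) R) :=
  forall N (A : nat -> set E), (forall k, measurable (A k)) ->
    Q (cylinder N A) = (\prod_(k < N) q (A k))%E.

Section theory.
Context d (E : measurableType d).
Implicit Types (q : probability E R) (Q : probability (seqspace E) R).

Lemma iid_law_unique q Q Q' : iid_law q Q -> iid_law q Q' ->
  forall B, measurable B -> Q B = Q' B.
Proof.
move=> hQ hQ'; apply: (@measure_unique _ R (seqspace E) (@cylinders _ E) (fun=> setT)).
- by [].
- exact: cylindersI.
- by move=> _; exists 0%N, (fun=> setT); split => //; rewrite cylinder0.
- by rewrite bigcup_const//; exists 0%N.
- by move=> _ [N [A [mA ->]]]; exact: etrans (hQ _ _ mA) (esym (hQ' _ _ mA)).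
- by move=> _; rewrite -ge0_fin_numE// fin_num_measure.
Qed.

Lemma eq_iid_law q q' Q : (forall A, measurable A -> q A = q' A) ->
  iid_law q Q -> iid_law q' Q.
Proof.
move=> qq' hQ N A mA; rewrite hQ//; apply: eq_bigr => k _; exact: qq'.
Qed.

Definition seqcons (p : E * seqspace E) : seqspace E :=
  fun k => if k is k'.+1 then p.2 k' else p.1.

Lemma measurable_seqcons : measurable_fun setT seqcons.
Proof.
apply: measurable_seqspace => -[|k]; first exact: measurable_fst.
exact: (measurableT_comp (measurable_coord k) measurable_snd).
Qed.

Lemma seqcons_cylinder N A : seqcons @^-1` cylinder N.+1 A =
  A 0%N `*` cylinder N (fun k => A k.+1).
Proof.
apply/seteqP; split => -[x a] /=.
  move=> aA; split; first exact: (aA 0%N).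
  by move=> k kN; exact: (aA k.+1).
by move=> [Ax Aa] [|k] kN //=; exact: Aa.
Qed.

(** This lets integrals over finitely many coordinates be computed by induction
    on their number. *)
Lemma iid_law_cons q Q : iid_law q Q -> forall B, measurable B ->
  Q B = product_prob q Q (seqcons @^-1` B).
Proof.
move=> hQ B mB; rewrite -(image_probE _ measurable_seqcons).
apply: (iid_law_unique hQ _ mB) => -[|N] A mA.
  by rewrite cylinder0 probability_setT big_ord0.
rewrite image_probE seqcons_cylinder product_probX//; last exact: measurable_cylinder.
by rewrite hQ// big_ord_recl.
Qed.

Lemma iid_law_integral_prod q Q N (f : nat -> E -> \bar R) : iid_law q Q ->
  (forall k, measurable_fun setT (f k)) -> (forall k x, 0 <= f k x)%E ->
  (\int[Q]_a \prod_(k < N) f k (a k) = \prod_(k < N) \int[q]_x f k x)%E.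
Proof.
move=> hQ; elim: N f => [|N IH] f mf f0.
  under eq_integral do rewrite big_ord0.
  by rewrite integral_cst// mul1e big_ord0; exact: probability_setT.
pose G (g : nat -> E -> \bar R) (a : seqspace E) := (\prod_(k < N) g k (a k))%E.
have mG (M : nat) (g : nat -> E -> \bar R) : (forall k, measurable_fun setT (g k)) ->
    measurable_fun setT (fun a : seqspace E => \prod_(k < M) g k (a k))%E.
  move=> mg; elim: M g mg => [|M IHM] g mg.
    apply: (eq_measurable_fun (cst 1%E)) => [a _|]; first by rewrite big_ord0.
    exact: measurable_cst.
  apply: (eq_measurable_fun (fun a : seqspace E =>
      (\prod_(k < M) g k (a k)) * g M (a M))%E) => [a _|].
    by rewrite big_ord_recr.
  apply: emeasurable_funM; first exact: IHM.
  exact: (measurableT_comp (mg M) (measurable_coord M)).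
have G0 (M : nat) (g : nat -> E -> \bar R) (a : seqspace E) :
    (forall k x, 0 <= g k x)%E -> (0 <= \prod_(k < M) g k (a k))%E.
  by move=> g0; apply: prode_ge0.
pose F (a : seqspace E) := (\prod_(k < N.+1) f k (a k))%E.
have -> : (\int[Q]_a F a = \int[image_prob (product_prob q Q) measurable_seqcons]_a F a)%E.
  by apply: eq_measure_integral => A mA _; exact: iid_law_cons.
rewrite ge0_integral_image; [|exact: (mG N.+1 f mf)|by move=> a; exact: (G0 N.+1 f a f0)].
have FE p : F (seqcons p) = (f 0%N p.1 * G (fun k => f k.+1) p.2)%E.
  by rewrite /F big_ord_recl.
under eq_integral do rewrite FE.
pose H (p : E * seqspace E) := (f 0%N p.1 * G (fun k => f k.+1) p.2)%E.
have mH : measurable_fun setT H.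
  apply: emeasurable_funM.
    exact: (measurableT_comp (mf 0%N) measurable_fst).
  exact: (measurableT_comp (mG N _ (fun k => mf k.+1)) measurable_snd).
have G0' a : (0 <= G (fun k => f k.+1) a)%E by exact: (G0 N (fun k => f k.+1)).
have H0 p : (0 <= H p)%E by rewrite mule_ge0.
rewrite [LHS](fubini_tonelli1 H)//.
transitivity (\int[q]_x (f 0%N x * \int[Q]_a G (fun k => f k.+1) a))%E.
  apply: eq_integral => x _; rewrite /fubini_F /H/= ge0_integralZl//.
  exact: (mG N _ (fun k => mf k.+1)).
rewrite ge0_integralZr//; last by apply: integral_ge0 => a _.
have -> : (\int[Q]_a G (fun k => f k.+1) a = \prod_(k < N) \int[q]_x f k.+1 x)%E.
  by apply: (IH (fun k => f k.+1)).
by rewrite big_ord_recl.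
Qed.

End theory.

Lemma iid_law_map d1 (E1 : measurableType d1) d2 (E2 : measurableType d2)
    (q : probability E1 R) (Q : probability (seqspace E1) R) (h : E1 -> E2)
    (mh : measurable_fun setT h)
    (mH : measurable_fun setT (fun a : seqspace E1 => (fun k => h (a k)) : seqspace E2)) :
  iid_law q Q -> iid_law (image_prob q mh) (image_prob Q mH).
Proof.
move=> hQ N A mA; rewrite image_probE.
rewrite [LHS](hQ N (fun k => h @^-1` A k))// => k.
by rewrite -[X in measurable X]setTI; exact: mh.
Qed.

(** Given the first sequence, the second one has independent coordinates, so
    the conditional probability of a cylinder is a product over coordinates;
    then the first one is integrated out with [iid_law_integral_prod]. *)
Lemma iid_law_map2 d1 (E1 : measurableType d1) d2 (E2 : measurableType d2)
    d3 (E3 : measurableType d3)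
    (q1 : probability E1 R) (Q1 : probability (seqspace E1) R)
    (q2 : probability E2 R) (Q2 : probability (seqspace E2) R)
    (g : E1 * E2 -> E3) (mg : measurable_fun setT g)
    (mG : measurable_fun setT (fun p : seqspace E1 * seqspace E2 =>
       (fun k => g (p.1 k, p.2 k)) : seqspace E3)) :
  iid_law q1 Q1 -> iid_law q2 Q2 ->
  iid_law (image_prob (product_prob q1 q2) mg)
          (image_prob (product_prob Q1 Q2) mG).
Proof.
move=> hQ1 hQ2 N A mA; rewrite image_probE product_prob_fubini; last first.
  by rewrite -[X in measurable X]setTI; apply: mG => //; exact: measurable_cylinder.
have mgA k : measurable (g @^-1` A k).
  by rewrite -[X in measurable X]setTI; exact: mg.
pose f k (x : E1) := q2 [set y | A k (g (x, y))].
have fE k : f k = q2 \o xsection (g @^-1` A k).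
  apply/funext => x; rewrite /f/=; congr (q2 _).
  by apply/seteqP; split => y /=; rewrite /xsection/= inE.
transitivity (\int[Q1]_a \prod_(k < N) f k (a k))%E.
  apply: eq_integral => a _.
  apply: (hQ2 N (fun k => [set y | A k (g (a k, y))])) => k.
  have -> : [set y | A k (g (a k, y))] = xsection (g @^-1` A k) (a k).
    by apply/seteqP; split => y /=; rewrite /xsection/= inE.
  exact: measurable_xsection.
rewrite (iid_law_integral_prod N hQ1)//.
  by apply: eq_bigr => k _; rewrite image_probE product_prob_fubini.
by move=> k; rewrite fE; exact: measurable_fun_xsection.
Qed.

End iid_law.

Section iid_charfun.
Context (R : realType).
Variables (q : probability R R) (psi : R -> R) (Q : probability (seqspace R) R).
Hypotheses (qpsi : symmetric_charfun q psi) (iidQ : iid_law q Q).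

Let lin N (c : nat -> R) (a : seqspace R) : R := \sum_(k < N) c k * a k.

Let measurable_lin N (c : nat -> R) : measurable_fun setT (lin N c).
Proof.
elim: N => [|N IH].
  apply: (eq_measurable_fun (cst 0 : seqspace R -> R)) => [a _|]; first by rewrite /lin big_ord0.
  exact: measurable_cst.
apply: (eq_measurable_fun (fun a : seqspace R => lin N c a + c N * a N)) => [a _|].
  by rewrite /lin big_ord_recr.
apply: measurable_funD => //; apply: measurable_funM => //.
exact: measurable_coord.
Qed.

Let lin_cons N c x (a : seqspace R) :
  lin N.+1 c (seqcons (x, a)) = c 0%N * x + lin N (fun k => c k.+1) a.
Proof. by rewrite /lin big_ord_recl. Qed.

Let Q_cons (f : seqspace R -> R) : measurable_fun setT f ->
  (forall a, `|f a| <= 1) ->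
  \int[Q]_a f a = \int[q]_x \int[Q]_a f (seqcons (x, a)).
Proof.
move=> mf f1.
have -> : \int[Q]_a f a =
    \int[image_prob (product_prob q Q) (@measurable_seqcons _ R)]_a f a.
  rewrite /Rintegral; congr fine; apply: eq_measure_integral => A mA _.
  exact: iid_law_cons.
rewrite (Rintegral_image _ _ mf f1).
pose g (p : R * seqspace R) := f (seqcons p).
have mg : measurable_fun setT g.
  exact: (measurableT_comp mf (@measurable_seqcons _ R)).
by rewrite -(bounded_fubini1 q Q mg (fun p => f1 _)).
Qed.

(** Induction on the number of terms by splitting off the first coordinate:
    in the addition formulas every sine term integrates to zero. *)
Lemma iid_charfun_sum N (c : nat -> R) :
  \int[Q]_a cos (\sum_(k < N) c k * a k) = \prod_(k < N) psi (c k) /\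
  \int[Q]_a sin (\sum_(k < N) c k * a k) = 0.
Proof.
rewrite -/(lin N c).
have mc M (e : nat -> R) : measurable_fun setT (fun a => cos (lin M e a)).
  apply: measurableT_comp => //.
  by apply: continuous_measurable_fun; exact: continuous_cos.
have ms M (e : nat -> R) : measurable_fun setT (fun a => sin (lin M e a)).
  apply: measurableT_comp => //.
  by apply: continuous_measurable_fun; exact: continuous_sin.
elim: N c => [|N IH] c.
  split.
    under eq_Rintegral do rewrite /lin big_ord0 cos0.
    rewrite Rintegral_cst// big_ord0 mul1r.
    exact: (congr1 fine (probability_setT Q)).
  under eq_Rintegral do rewrite /lin big_ord0 sin0.
  by rewrite Rintegral_cst// mul0r.
have [IHc IHs] := IH (fun k => c k.+1).
have iC (r : R) := integrableZl measurableT r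
  (integrable_cosM Q (measurable_lin N (fun k => c k.+1))).
have iS (r : R) := integrableZl measurableT r
  (integrable_sinM Q (measurable_lin N (fun k => c k.+1))).
have mM : measurable_fun setT (fun x : R => c 0%N * x) by exact: measurable_funM.
split.
  rewrite (Q_cons (mc _ _)) => [|a]; last exact: cos_max.
  transitivity (\int[q]_x (cos (c 0%N * x) * \prod_(k < N) psi (c k.+1))).
    apply: eq_Rintegral => x _.
    under eq_Rintegral do rewrite lin_cons cosD.
    rewrite RintegralB//; [|exact: iC|exact: iS].
    rewrite RintegralZl//; last exact: integrable_cosM.
    rewrite RintegralZl//; last exact: integrable_sinM.
    by rewrite IHc IHs mulr0 subr0.
  rewrite RintegralZr//; last exact: integrable_cosM.
  by rewrite (qpsi _).1 big_ord_recl.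
rewrite (Q_cons (ms _ _)) => [|a]; last exact: sin_max.
transitivity (\int[q]_x (sin (c 0%N * x) * \prod_(k < N) psi (c k.+1))).
  apply: eq_Rintegral => x _.
  under eq_Rintegral do rewrite lin_cons sinD.
  rewrite RintegralD//; [|exact: iC|exact: iS].
  rewrite RintegralZl//; last exact: integrable_cosM.
  rewrite RintegralZl//; last exact: integrable_sinM.
  by rewrite IHc IHs mulr0 addr0.
rewrite RintegralZr//; last exact: integrable_sinM.
by rewrite (qpsi _).2 mul0r.
Qed.

End iid_charfun.

(** * Measurability in a separable Banach space *)

Section separability.
Context (R : realType) (X : normedModType R).

Definition dense_seq (D : nat -> X) :=
  forall (y : X) (e : R), 0 < e -> exists n, `|y - D n| < e.

Definition rat_comb (x : nat -> X) (s : seq rat) : X :=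
  \sum_(k < size s) ratr s`_k *: x k.

(** Every vector is close to a partial sum of its basis expansion, and since
    the basis is normalized the finitely many coefficients can be replaced by
    rational ones. *)
Lemma basis_dense_seq (x : nat -> X) : schauder_basis x -> normalized x ->
  dense_seq (fun n => rat_comb x (odflt [::] (unpickle n))).
Proof.
move=> bx nx y e e0.
have [a [ay _]] := bx y.
have [N yN] : exists N, `|y - series (fun k => a k *: x k) N| < e / 2.
  have e20 : 0 < e / 2 by rewrite divr_gt0.
  move/cvgrPdist_lt : ay => /(_ _ e20)[N _ /(_ N (leqnn N)) yN].
  by exists N.
pose d := e / 2 / N.+1%:R.
have d0 : 0 < d by rewrite !divr_gt0.
have /choice[r rP] : forall k, exists r : rat, `|a k - ratr r| < d.
  move=> k; have : a k < a k + d by rewrite ltrDl.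
  move=> /rat_in_itvoo[r]; rewrite in_itv/= => /andP[r1 r2]; exists r.
  by rewrite distrC gtr0_norm ?subr_gt0// ltrBlDl.
exists (pickle (mkseq r N)); rewrite pickleK/= /rat_comb.
rewrite size_mkseq -(subrKA (series (fun k => a k *: x k) N)).
rewrite (le_lt_trans (ler_normD _ _))// (splitr e) ltr_leD//.
rewrite /series/= big_mkord -sumrB (le_trans (ler_norm_sum _ _ _))//.
apply: (@le_trans _ _ (\sum_(k < N) d)).
  apply: ler_sum => k _; rewrite nth_mkseq// -scalerBl normrZ nx mulr1.
  exact/ltW/rP.
rewrite sumr_const card_ord -[leLHS]mulr_natr /d mulrAC ler_pdivrMr ?ltr0n//.
by rewrite ler_wpM2l ?ler_nat// ltW// divr_gt0.
Qed.

End separability.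

Section borel_separable.
Context (R : realType) (X : normedModType R) (D : nat -> X).
Hypothesis dD : dense_seq D.

Lemma measurable_open (U : set X) : open U -> measurable (U : set (borel X)).
Proof. exact: sub_sigma_algebra. Qed.

Lemma measurable_closed (F : set X) : closed F -> measurable (F : set (borel X)).
Proof.
by rewrite -openC => /measurable_open/measurableC; rewrite setCK.
Qed.

Lemma continuous_borel_measurable (Y : normedModType R) (f : X -> Y) :
  continuous f -> measurable_fun setT (f : borel X -> borel Y).
Proof.
move=> /continuousP cf.
apply: (@measurability _ _ (borel X) (borel Y) setT f (@open Y)) => // _ [U oU <-].
by rewrite setTI; apply: measurable_open; exact: cf.
Qed.

Lemma measurable_norm_borel : measurable_fun setT (fun y : borel X => `|y : X|).
Proof.
apply: (@measurability _ _ (borel X) R setT _ _ (RGenOpens.measurableE R)).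
move=> _ [_ [a [b ->]] <-]; rewrite setTI; apply: measurable_open.
apply: open_comp; last exact: itv_open.
by move=> y _; exact: norm_continuous.
Qed.

(** In a separable space every open set is a countable union of small balls
    centred at the points of a dense sequence. *)
Lemma dense_ball (U : set X) (y : X) : open U -> U y -> exists n m,
  `|y - D n| < m.+1%:R^-1 /\ ball (D n) m.+1%:R^-1 `<=` U.
Proof.
move=> oU Uy; have /nbhs_ballP[e e0 eU] : nbhs y U by exact: open_nbhs_nbhs.
have e20 : 0 < e / 2 by rewrite divr_gt0.
have [m _ /(_ m (leqnn m))/= me] := near_infty_natSinv_lt (PosNum e20).
have [n yn] : exists n, `|y - D n| < m.+1%:R^-1 by exact: dD.
exists n, m; split => // z; rewrite -ball_normE/= => nz; apply: eU.
rewrite -ball_normE/= -(subrKA (D n)) (le_lt_trans (ler_normD _ _))//.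
rewrite (splitr e) ltrD//.
  exact: lt_trans yn me.
exact: lt_trans nz me.
Qed.

(** By [dense_ball], preimages of countably many balls decide measurability. *)
Lemma measurable_fun_borel d (T : measurableType d) (f : T -> borel X) :
  (forall n m, measurable (f @^-1` ball (D n) m.+1%:R^-1)) ->
  measurable_fun setT f.
Proof.
move=> mf; apply: (@measurability _ _ T (borel X) setT f (@open X)) => // _ [U oU <-].
rewrite setTI.
have -> : f @^-1` U = \bigcup_n \bigcup_m
    (if `[< ball (D n) m.+1%:R^-1 `<=` U >] then f @^-1` ball (D n) m.+1%:R^-1
     else set0).
  apply/seteqP; split => t /=.
    move=> /(dense_ball oU)[n [m [ft sU]]]; exists n => //; exists m => //.
    by case: asboolP => // _; rewrite /= -ball_normE/= distrC.
  by move=> [n _ [m _]]; case: asboolP => // sU /sU.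
by apply: bigcupT_measurable => n; apply: bigcupT_measurable => m; case: ifP.
Qed.

(** By separability an open set of pairs is a countable union of products of
    balls, so it belongs to the product sigma-algebra.  This is what makes
    addition of random vectors measurable. *)
Lemma measurable_open_prod (W : set (X * X)) : open W ->
  measurable (W : set (borel X * borel X)).
Proof.
move=> oW.
pose dec (i : nat) : nat * nat * (nat * nat) := odflt (0, 0, (0, 0))%N (unpickle i).
pose B (j : nat * nat) : set X := ball (D j.1) j.2.+1%:R^-1.
have -> : W = \bigcup_i (if `[< B (dec i).1 `*` B (dec i).2 `<=` W >]
    then B (dec i).1 `*` B (dec i).2 else set0).
  apply/seteqP; split => p /=.
    move=> Wp; have /nbhs_ballP[e /= e0 eW] : nbhs p W by exact: open_nbhs_nbhs.
    have [n1 [m1 [p1 s1]]] := dense_ball (@ball_open _ _ p.1 e) (ballxx p.1 e0).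
    have [n2 [m2 [p2 s2]]] := dense_ball (@ball_open _ _ p.2 e) (ballxx p.2 e0).
    exists (pickle ((n1, m1), (n2, m2))) => //; rewrite /dec pickleK/=.
    case: asboolP => /=.
      by move=> _; rewrite /B/= -!ball_normE/= ![`|D _ - _|]distrC.
    by move=> []; move=> z [z1 z2]; apply: eW; split; [exact: s1|exact: s2].
  by move=> [i _]; case: asboolP => // sW /sW.
apply: bigcupT_measurable => i; case: ifP => // _.
by apply: measurableX; apply: measurable_open; exact: ball_open.
Qed.

Lemma measurable_fun_continuous2 (Y : normedModType R) (f : X * X -> Y) :
  continuous f ->
  measurable_fun setT (f : borel X * borel X -> borel Y).
Proof.
move=> /continuousP cf.
apply: (@measurability _ _ (borel X * borel X)%type (borel Y) setT f (@open Y)) => // _ [U oU <-].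
by rewrite setTI; apply: measurable_open_prod; exact: cf.
Qed.

Lemma measurable_add_borel :
  measurable_fun setT (fun p : borel X * borel X => (p.1 : X) + p.2 : borel X).
Proof. by apply: measurable_fun_continuous2 => p; exact: add_continuous. Qed.

Lemma measurable_addB d (T : measurableType d) (f g : T -> borel X) :
  measurable_fun setT f -> measurable_fun setT g ->
  measurable_fun setT (fun t => (f t : X) + g t : borel X).
Proof.
move=> mf mg.
exact: (measurableT_comp measurable_add_borel (measurable_fun_pair mf mg)).
Qed.

Lemma measurable_subB d (T : measurableType d) (f g : T -> borel X) :
  measurable_fun setT f -> measurable_fun setT g ->
  measurable_fun setT (fun t => (f t : X) - g t : borel X).
Proof.
move=> mf mg; apply: measurable_addB => //.
apply: (measurableT_comp _ mg).
by apply: (@continuous_borel_measurable X (fun y : X => - y)) => y; exact: opp_continuous.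
Qed.

Lemma measurable_scaleB d (T : measurableType d) (f : T -> R) (v : X) :
  measurable_fun setT f -> measurable_fun setT (fun t => f t *: v : borel X).
Proof.
move=> mf.
apply: (@measurability _ _ T (borel X) setT _ (@open X)) => // _ [U oU <-].
rewrite setTI -[X in measurable X]/(f @^-1` ((fun r : R => r *: v) @^-1` U)).
rewrite -[X in measurable X]setTI; apply: mf => //.
apply: open_measurable; apply: open_comp => // r _.
exact: scalel_continuous.
Qed.

Lemma measurable_sumB d (T : measurableType d) (f : nat -> T -> borel X) N :
  (forall k, measurable_fun setT (f k)) ->
  measurable_fun setT (fun t => \sum_(0 <= k < N) (f k t : X) : borel X).
Proof.
move=> mf; elim: N => [|N IH].
  apply: (eq_measurable_fun (cst (0 : X) : T -> borel X)) => [t _|].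
    by rewrite big_geq.
  exact: measurable_cst.
apply: (eq_measurable_fun (fun t => \sum_(0 <= k < N) (f k t : X) + f N t : borel X)) => [t _|].
  by rewrite big_nat_recr.
exact: measurable_addB.
Qed.

End borel_separable.

Section measurable_limit.
Context (R : realType) (X : completeNormedModType R) (D : nat -> X).
Hypothesis dD : dense_seq D.
Context d (T : measurableType d) (u : nat -> T -> borel X).
Hypothesis mu_ : forall n, measurable_fun setT (u n).

Definition cvg_set : set T := [set t | cvgn ((u ^~ t) : nat -> X)].

(** By completeness the set is described by the Cauchy criterion, which only
    involves countable unions and intersections. *)
Lemma measurable_cvg_set : measurable cvg_set.
Proof.
have -> : cvg_set = \bigcap_m \bigcup_N \bigcap_j
    [set t | `|(u N t : X) - u (N + j)%N t| < m.+1%:R^-1].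
  apply/seteqP; split => t /=.
    move=> /cvg_ex[l /cvgrPdist_lt ul] m _.
    have m0 : 0 < m.+1%:R^-1 / 2 :> R by rewrite divr_gt0.
    have [N _ uN] := ul _ m0; exists N => // j _ /=.
    rewrite -(subrKA l) (le_lt_trans (ler_normD _ _))// (splitr m.+1%:R^-1).
    rewrite distrC ltrD//; first exact: (uN N (leqnn N)).
    exact: (uN (N + j)%N (leq_addr _ _)).
  move=> cu; apply: cauchy_cvg; apply/cauchyP => e e0.
  have [m _ /(_ m (leqnn m))/= me] := near_infty_natSinv_lt (PosNum e0).
  have [N _ uN] := cu m I; exists (u N t); exists N => // n /= Nn.
  rewrite /= -ball_normE/= -(subnKC Nn); apply: lt_trans me.
  exact: (uN (n - N)%N I).
apply: bigcapT_measurable => m; apply: bigcupT_measurable => N.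
apply: bigcapT_measurable => j.
have mn : measurable_fun setT (fun t => `|(u N t : X) - u (N + j)%N t|).
  exact: (measurableT_comp (@measurable_norm_borel _ X)
    (measurable_subB dD (mu_ N) (mu_ (N + j)%N))).
rewrite [X in measurable X](_ : _ = (fun t => `|(u N t : X) - u (N + j)%N t|)
   @^-1` `]-oo, m.+1%:R^-1[%classic).
  by rewrite -[X in measurable X]setTI; exact: mn.
by apply/seteqP; split => t /=; rewrite in_itv.
Qed.

Definition lim_or0 (t : T) : borel X :=
  if `[< cvg_set t >] then limn ((u ^~ t) : nat -> X) else 0.

Lemma measurable_lim_or0 : measurable_fun setT lim_or0.
Proof.
(* a modification of [u] that converges everywhere *)
pose v n t : borel X := if `[< cvg_set t >] then u n t else (0 : X).
have mv n : measurable_fun setT (v n).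
  apply: measurable_fun_ifT => //.
  apply: (measurable_fun_bool true); rewrite setTI.
  rewrite [X in measurable X](_ : _ = cvg_set); first exact: measurable_cvg_set.
  by apply/seteqP; split => t /= /asboolP.
have vl t : ((v ^~ t) : nat -> X) @ \oo --> (lim_or0 t : X).
  rewrite /v /lim_or0; case: asboolP => // _; exact: cvg_cst.
apply: (measurable_fun_borel dD) => n m.
have mf : measurable_fun setT (fun t => `|D n - (lim_or0 t : X)|).
  apply: (@measurable_fun_cvg _ _ _ _ (fun k t => `|D n - (v k t : X)|)).
    move=> k; apply: (measurableT_comp (@measurable_norm_borel _ X)).
    exact: (measurable_subB dD (f := fun=> D n)).
  by move=> t _; apply: cvg_norm; apply: cvgB; [exact: cvg_cst|exact: vl].
rewrite [X in measurable X](_ : _ = (fun t => `|D n - (lim_or0 t : X)|)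
   @^-1` `]-oo, m.+1%:R^-1[%classic).
  by rewrite -[X in measurable X]setTI; exact: mf.
by apply/seteqP; split => t /=; rewrite in_itv/= -ball_normE.
Qed.

End measurable_limit.

(** * Borel laws on a separable Banach space are Radon *)

Section small_measure.
Context d (T : measurableType d) (R : realType) (mu : probability T R).

Lemma measure_vanish (B : nat -> set T) (e : R) : 0 < e ->
  (forall n, measurable (B n)) -> nonincreasing_seq B ->
  \bigcap_n B n = set0 -> exists n, (mu (B n) <= e%:E)%E.
Proof.
move=> e0 mB nB B0.
have cB : mu \o B @ \oo --> mu (\bigcap_n B n).
  apply: nonincreasing_cvg_mu => //.
  - by rewrite -ge0_fin_numE// fin_num_measure.
  - by rewrite B0.
have /fine_cvg : mu \o B @ \oo --> (0 : R)%:E by rewrite -[0%:E](measure0 mu) -B0.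
move=> /cvgrPdist_le/(_ _ e0)[n _ /(_ n (leqnn n))/=].
rewrite sub0r normrN ger0_norm ?fine_ge0// => Bn; exists n.
by rewrite -[leLHS]fineK ?lee_fin// fin_num_measure.
Qed.

Lemma measure_bigcup_le (B : nat -> set T) (e : R) : 0 <= e ->
  (forall n, measurable (B n)) ->
  (forall n, (mu (B n) <= (e / (2 ^ n.+1)%:R)%:E)%E) ->
  (mu (\bigcup_n B n) <= e%:E)%E.
Proof.
move=> e0 mB Be.
have mUB : measurable (\bigcup_n B n) by exact: bigcupT_measurable.
have := @measure_sigma_subadditive _ _ _ mu _ _ mB mUB (@subset_refl _ _).
move=> /le_trans; apply; apply: le_trans (epsilon_trick0 predT e0).
by apply: lee_nneseries => // n _; exact: Be.
Qed.

End small_measure.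

Section radon.
Context (R : realType) (X : completeNormedModType R) (D : nat -> X).
Hypothesis dD : dense_seq D.
Variable mu : probability (borel X) R.

Definition closed_open_regular (A : set X) := forall e : R, 0 < e ->
  exists F U : set X, [/\ closed F, open U, F `<=` A, A `<=` U &
    (mu (U `\` F) <= e%:E)%E].

Let mopen (U : set X) : open U -> measurable (U : set (borel X)).
Proof. exact: measurable_open. Qed.

Let mclosed (F : set X) : closed F -> measurable (F : set (borel X)).
Proof. exact: measurable_closed. Qed.

(** The closed sets are the complements of the [m.+1%:R^-1]-neighbourhoods of
    [~` U]; they exhaust [U]. *)
Lemma closed_open_regular_open (U : set X) : open U -> closed_open_regular U.
Proof.
move=> oU e e0.
pose G m : set X := \bigcup_(y in ~` U) ball y m.+1%:R^-1.
have oG m : open (G m) by apply: bigcup_open => y _; exact: ball_open.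
have [|||m mUG] := @measure_vanish _ _ _ mu (fun m => U `&` G m) e e0.
- by move=> m; apply: measurableI; exact: mopen.
- move=> m n mn; apply/subsetPset => y [Uy [z Uz yz]]; split => //.
  exists z => //; apply: le_ball yz.
  by rewrite lef_pV2 ?posrE// ler_nat.
- rewrite -subset0 => y /= yG; have [Uy _] := yG 0%N I.
  have /nbhs_ballP[r /= r0 rU] : nbhs y U by exact: open_nbhs_nbhs.
  have [m _ /(_ m (leqnn m))/= mr] := near_infty_natSinv_lt (PosNum r0).
  have [_ [z Uz zy]] := yG m I; apply: Uz; apply: rU.
  exact: le_ball (ltW mr) _ (ball_sym zy).
- exists (~` G m), U; split => //.
  + exact: open_closedC.
  + move=> y nGy; apply: contrapT => nUy; apply: nGy; exists y => //.
    by apply: ballxx; rewrite invr_gt0.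
  + by rewrite setDE setCK; exact: mUG.
Qed.

(** The open sets are united over all [n], with errors summing to [e / 2]; a
    countable union of closed sets need not be closed, so it is cut at an index
    [N] beyond which less than [e / 2] is lost. *)
Lemma closed_open_regular_bigcup (A : nat -> set X) :
  (forall n, closed_open_regular (A n)) -> closed_open_regular (\bigcup_n A n).
Proof.
move=> rA e e0.
have e20 : 0 < e / 2 by rewrite divr_gt0.
have /choice[FU FUP] : forall n, exists FU : set X * set X,
    [/\ closed FU.1, open FU.2, FU.1 `<=` A n, A n `<=` FU.2 &
    (mu (FU.2 `\` FU.1) <= (e / 2 / (2 ^ n.+1)%:R)%:E)%E].
  move=> n; have en0 : 0 < e / 2 / (2 ^ n.+1)%:R by rewrite divr_gt0// ltr0n expn_gt0.
  by have [F [U FUn]] := rA n _ en0; exists (F, U).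
pose F n := (FU n).1; pose U n := (FU n).2.
have cF n : closed (F n) by have [] := FUP n.
have oU n : open (U n) by have [] := FUP n.
have FA n : F n `<=` A n by have [] := FUP n.
have AU n : A n `<=` U n by have [] := FUP n.
have UF n : (mu (U n `\` F n) <= (e / 2 / (2 ^ n.+1)%:R)%:E)%E by have [] := FUP n.
pose FN N := \bigcup_(n in `I_N) F n.
have cFN N : closed (FN N) by apply: closed_bigcup => //; exact: finite_II.
have mF : measurable (\bigcup_n F n : set (borel X)).
  by apply: bigcupT_measurable => n; exact: mclosed.
have [|||N mN] := @measure_vanish _ _ _ mu (fun N => (\bigcup_n F n) `\` FN N) _ e20.
- by move=> N; apply: measurableD => //; exact: mclosed.
- move=> m n mn; apply/subsetPset => y [Fy Fny]; split => // -[k km Fky].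
  by apply: Fny; exists k => //; exact: leq_trans mn.
- rewrite -subset0 => y /= yF; have [[n _ Fny] _] := yF 0%N I.
  by have [_] := yF n.+1 I; apply; exists n => /=.
exists (FN N), (\bigcup_n U n); split => //.
- by apply: bigcup_open => n _; exact: oU.
- by move=> y [n _ Fny]; exists n => //; exact: FA.
- by move=> y [n _ Any]; exists n => //; exact: AU.
- have mUF n : measurable (U n `\` F n : set (borel X)).
    by apply: measurableD; [exact: mopen|exact: mclosed].
  apply: (@le_trans _ _ (mu ((\bigcup_n (U n `\` F n)) `|`
      ((\bigcup_n F n) `\` FN N)))).
    apply: le_measure; rewrite ?inE.
    + apply: measurableD; last exact: mclosed.
      by apply: bigcupT_measurable => n; exact: mopen.
    + apply: measurableU; first exact: bigcupT_measurable.
      by apply: measurableD => //; exact: mclosed.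
    + move=> y [[n _ Uny] FNy]; have [Fy|nFy] := pselect ((\bigcup_n F n) y).
        by right.
      by left; exists n => //; split => // Fny; apply: nFy; exists n.
  apply: le_trans (measureU2 _ _ _) _.
  + exact: bigcupT_measurable.
  + by apply: measurableD => //; exact: mclosed.
  rewrite (splitr e) EFinD leeD//.
  by apply: measure_bigcup_le => //; exact: ltW.
Qed.

(** The regular sets form a sigma-algebra that contains the open sets. *)
Lemma borel_closed_open_regular (A : set (borel X)) : measurable A ->
  closed_open_regular A.
Proof.
apply: smallest_sub; last exact: closed_open_regular_open.
split.
- move=> e e0; exists set0, set0; split => //; [exact: closed0|exact: open0|].
  by rewrite setD0 measure0 lee_fin ltW.
- move=> B rB e e0; have [F [U [cF oU FB BU UF]]] := rB e e0.
  exists (~` U), (~` F); split.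
  + exact: open_closedC.
  + exact: closed_openC.
  + by rewrite setTD; exact: subsetC.
  + by rewrite setTD; exact: subsetC.
  + by rewrite setDE setCK setIC -setDE.
- exact: closed_open_regular_bigcup.
Qed.

Let cball (i m : nat) : set X := closed_ball_ Num.norm (D i) m.+1%:R^-1.

Lemma ultra_bigcupII (T : Type) (F : set_system T) (B : nat -> set T) N :
  UltraFilter F -> F (\bigcup_(i in `I_N) B i) -> exists i, F (B i).
Proof.
move=> UF; elim: N => [|N IH].
  by rewrite II0 bigcup_set0 => /filter_not_empty.
have [FB|FB] := in_ultra_setVsetC (B N) UF; first by exists N.
move=> FBN; apply: IH; apply: filterS (filterI FBN FB) => y [[i /= iN Bi] Ny].
by exists i => //=; move: iN; rewrite ltnS leq_eqVlt => /predU1P[iN|//]; rewrite -iN in Ny.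
Qed.

(** An ultrafilter on a set covered by finitely many balls of each small radius
    contains one ball of each radius, hence is Cauchy. *)
Lemma totally_bounded_compact (K : set X) : closed K ->
  (forall m, exists N, K `<=` \bigcup_(i in `I_N) cball i m) -> compact K.
Proof.
move=> cK tK; rewrite compact_ultra => F UF FK.
have PF : ProperFilter F by exact: ultra_proper.
have cF : cauchy F.
  apply/cauchyP => e e0.
  have [m _ /(_ m (leqnn m))/= me] := near_infty_natSinv_lt (PosNum e0).
  have [N KN] := tK m.
  have [i Fi] : exists i, F (cball i m) by apply: ultra_bigcupII (filterS KN FK).
  exists (D i); apply: filterS Fi => y; rewrite -ball_normE /cball/closed_ball_/=.
  by move=> /le_lt_trans; apply.
have Fl : F --> lim F by exact: cauchy_cvg.
exists (lim F); split => //; apply: cK => B /Fl FB.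
exact: filter_ex (filterI FK FB).
Qed.

(** Ulam: finitely many balls of radius [m.+1%:R^-1] cover everything up to mass
    [e / 2 ^ m.+1], and the intersection of these unions over all [m] is
    compact. *)
Lemma tight (e : R) : 0 < e -> exists K : set X, compact K /\ (mu (~` K) <= e%:E)%E.
Proof.
move=> e0.
pose B m N : set X := ~` \bigcup_(i in `I_N) cball i m.
have cU m N : closed (\bigcup_(i in `I_N) cball i m).
  by apply: closed_bigcup => [|i _]; [exact: finite_II|exact: closed_closed_ball_].
have mB m N : measurable (B m N : set (borel X)).
  by apply: mopen; exact: closed_openC.
have /choice[Nm NmP] : forall m, exists N,
    (mu (B m N) <= (e / (2 ^ m.+1)%:R)%:E)%E.
  move=> m; have em0 : 0 < e / (2 ^ m.+1)%:R by rewrite divr_gt0// ltr0n expn_gt0.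
  apply: measure_vanish em0 (mB m) _ _.
    move=> p n pn; apply/subsetPset => y By [i /= ip yi]; apply: By.
    by exists i => //=; exact: leq_trans pn.
  rewrite -subset0 => y yB.
  have m0 : 0 < m.+1%:R^-1 :> R by rewrite invr_gt0.
  have [i yi] := dD y m0; apply: (yB i.+1 I); exists i => //=.
  by rewrite /cball/closed_ball_/= distrC ltW.
exists (\bigcap_m \bigcup_(i in `I_(Nm m)) cball i m); split.
  apply: totally_bounded_compact.
    by apply: closed_bigI => m _; exact: cU.
  by move=> m; exists (Nm m) => y /(_ m I).
rewrite setC_bigcap; apply: measure_bigcup_le => //; first exact: ltW.
by move=> m; exact: mB.
Qed.

(** A closed set approximating [A] from inside is intersected with a compact set
    that carries nearly all the mass. *)
Lemma borel_prob_radon : radon mu.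
Proof.
move=> A mA; apply/eqP; rewrite eq_le; apply/andP; split; last first.
  apply: ub_ereal_sup => _ [K [cK KA] <-]; apply: le_measure; rewrite ?inE//.
  by apply: mclosed; exact: compact_closed.
apply/lee_addgt0Pr => e e0.
have e20 : 0 < e / 2 by rewrite divr_gt0.
have [F [U [cF oU FA AU UF]]] := borel_closed_open_regular mA e20.
have [K [cK mK]] := tight e20.
have clK : closed K by exact: compact_closed.
have mFK : measurable (K `&` F : set (borel X)).
  by apply: measurableI; exact: mclosed.
apply: (@le_trans _ _ (mu (K `&` F) + e%:E)%E); last first.
  rewrite leeD2r//; apply: ereal_sup_ubound; exists (K `&` F) => //; split.
    exact: compact_closedI.
  by move=> y [_ /FA].
apply: (@le_trans _ _ (mu ((K `&` F) `|` ((U `\` F) `|` ~` K)))).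
  apply: le_measure; rewrite ?inE//.
    apply: measurableU => //; apply: measurableU.
      by apply: measurableD; [exact: mopen|exact: mclosed].
    by apply: measurableC; exact: mclosed.
  move=> y Ay; have [Ky|nKy] := pselect (K y); last by right; right.
  have [Fy|nFy] := pselect (F y); first by left.
  by right; left; split => //; exact: AU.
have mUF : measurable (U `\` F : set (borel X)).
  by apply: measurableD; [exact: mopen|exact: mclosed].
have mCK : measurable (~` K : set (borel X)) by apply: measurableC; exact: mclosed.
apply: le_trans (measureU2 _ _ _) _ => //; first exact: measurableU.
rewrite leeD2l// (splitr e) EFinD.
by apply: le_trans (measureU2 _ _ _) _ => //; exact: leeD.
Qed.

End radon.

(** * Levy-Khintchine laws and their roots *)

Lemma Rintegral_distribution d (T : measurableType d) (R : realType)
    (P : probability T R) (xi : {RV P >-> R}) (f : R -> R) (M : R) :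
  measurable_fun setT f -> (forall y, `|f y| <= M) ->
  \int[distribution P xi]_y f y = \int[P]_w f (xi w).
Proof.
move=> mf fM; have mxi : measurable_fun setT xi by exact: measurable_funPT.
exact: (Rintegral_image P mxi mf fM).
Qed.

Section levy_khintchine.
Context (R : realType).
Variable lambda : {finite_measure set (measurableTypeR R) -> \bar R}.
Hypothesis lambda_sym : symmetric_measure lambda.

(** The imaginary part of the Levy-Khintchine exponent is the integral [S] of an
    odd function, which vanishes by symmetry of [lambda]. *)
Lemma ID0_symmetric_charfun d (T : measurableType d) (P : probability T R)
    (xi : {RV P >-> R}) (s2 : R) : ID0 xi s2 lambda ->
  symmetric_charfun (distribution P xi) (fun z => expR (- (s2 * z ^+ 2 / 2) +
    \int[lambda]_t (cos (z * t) - 1))).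
Proof.
move=> xiID z.
have -> : \int[distribution P xi]_x cos (z * x) = \int[P]_w cos (z * xi w).
  apply: (@Rintegral_distribution _ _ _ P xi (fun x => cos (z * x)) 1).
    exact: measurable_cosM.
  by move=> y; exact: cos_max.
have -> : \int[distribution P xi]_x sin (z * x) = \int[P]_w sin (z * xi w).
  apply: (@Rintegral_distribution _ _ _ P xi (fun x => sin (z * x)) 1).
    exact: measurable_sinM.
  by move=> y; exact: sin_max.
have := xiID z; rewrite /cintegral /cexp /=.
set S := (X in cos (- 0 + X)); set C := (X in expR (_ + X)).
have S0 : S = 0.
  apply: (Rintegral_symmetric_odd lambda_sym (M := 1 + `|z|)).
  - apply: measurable_funB.
      apply: measurable_funB => //; apply: measurable_funM => //.
      under eq_fun do rewrite mulrC.
      exact: measurable_sinM.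
    apply: measurable_funM; first exact: measurable_funM.
    apply: measurable_indic.
    rewrite (_ : [set r : R | `|r| < 1] = `]-1, 1[%classic); first exact: measurable_itv.
    by apply/seteqP; split => r /=; rewrite in_itv/= ltr_norml.
  - move=> t; rewrite expR0 mul1r subr0 (le_trans (ler_normB _ _))// lerD ?sin_max//.
    rewrite indicE; have [|_] := boolP (t \in _); last by rewrite mulr0 normr0.
    by rewrite inE/= => t1; rewrite mulr1 normrM ler_piMl// ltW.
  - move=> t; rewrite mulNr sinN.
    have -> : \1_[set r : R | `|r| < 1] (- t) = \1_[set r : R | `|r| < 1] t :> R.
      by rewrite !indicE; congr (nat_of_bool _)%:R; apply/idP/idP; rewrite !inE/= normrN.
    ring.
have CE : C = \int[lambda]_t (cos (z * t) - 1).
  by apply: eq_Rintegral => t _; rewrite expR0 mul1r subr0 mulrC.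
rewrite [X in sin (- 0 + X)](_ : _ = S)// S0 CE oppr0 add0r cos0 sin0 mulr1 mulr0 => -[ReE ImE]; split.
  transitivity (\int[P]_t (expR 0 * cos (z * xi t))).
    by apply: eq_Rintegral => w _; rewrite expR0 mul1r.
  by rewrite ReE; congr (expR (- _ + _)); field.
rewrite -[RHS]ImE.
by apply: eq_Rintegral => w _; rewrite expR0 mul1r.
Qed.

(** The root divides both the Gaussian variance and the jump measure by [n]. *)
Lemma gauss_poisson_root (sigma : R) (n : nat) : sigma != 0 -> (0 < n)%N ->
  exists rho : probability R R, exists theta : R -> R,
  [/\ forall x, rho [set x] = 0%E, symmetric_charfun rho theta &
   forall z, theta z ^+ n = expR (- (sigma ^+ 2 * z ^+ 2 / 2) +
     \int[lambda]_t (cos (z * t) - 1))].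
Proof.
move=> s0 n0.
have n0' : 0 < n%:R :> R by rewrite ltr0n.
have tau0 : sigma / Num.sqrt n%:R != 0 by rewrite mulf_neq0// invr_eq0 gt_eqF// sqrtr_gt0.
have n1 : 0 <= n%:R^-1 :> R by rewrite invr_ge0 ltW.
have [rho [rho0 rhoC]] := gauss_poisson_law lambda_sym (NngNum n1) tau0.
eexists; eexists; split; [exact: rho0|exact: rhoC|] => z /=.
rewrite -expRM_natl; congr expR.
rewrite exprMn exprVn sqr_sqrtr ?ltW//.
by move: (\int[lambda]_t _) => J; field; rewrite gt_eqF.
Qed.

End levy_khintchine.

Section law_of_sequence.
Context d (T : measurableType d) (R : realType) (P : probability T R).
Variable xi : nat -> {RV P >-> R}.

Lemma measurable_rv_seq :
  measurable_fun setT (fun w => (fun k => xi k w) : seqspace R).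
Proof. by apply: measurable_seqspace => k; exact: measurable_funPT. Qed.

Lemma iid_iid_law : iid xi ->
  iid_law (distribution P (xi 0%N)) (image_prob P measurable_rv_seq).
Proof.
move=> [ind idd] N A mA; rewrite image_probE.
have := ind (iota 0 N) A (iota_uniq _ _) mA.
rewrite -(big_mkord predT (fun k => distribution P (xi 0%N) (A k))).
have -> : \bigcap_(k in [set` iota 0 N]) (xi k @^-1` A k) =
    (fun w => (fun k => xi k w) : seqspace R) @^-1` cylinder N A.
  apply/seteqP; split => w /= wA k; last first.
    by rewrite /= mem_iota/= add0n => kN; exact: wA.
  by move=> kN; apply: wA; rewrite /= mem_iota.
move=> ->; rewrite /index_iota subn0; apply: eq_bigr => k _.
exact: idd.
Qed.

End law_of_sequence.

(** * Sums of independent sequences, and random series *)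

Lemma probability_nullU d (T : measurableType d) (R : realType)
    (P : probability T R) (A B : set T) : measurable A -> measurable B ->
  P A = 0%E -> P B = 0%E -> P (A `|` B) = 0%E.
Proof. by move=> mA mB A0 B0; rewrite measureU0. Qed.

Lemma probability_null_subset d (T : measurableType d) (R : realType)
    (P : probability T R) (A B : set T) : measurable A -> measurable B ->
  A `<=` B -> P B = 0%E -> P A = 0%E.
Proof. exact: subset_measure0. Qed.

Section sequence_convolution.
Context (R : realType).
Implicit Types (q : probability R R) (Q : probability (seqspace R) R).

Lemma measurable_pairwise (g : R * R -> R) : measurable_fun setT g ->
  measurable_fun setT (fun p : seqspace R * seqspace R =>
    (fun k => g (p.1 k, p.2 k)) : seqspace R).
Proof.
move=> mg; apply: measurable_seqspace => k.
apply: (measurableT_comp mg); apply: measurable_fun_pair.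
  exact: (measurableT_comp (measurable_coord k) measurable_fst).
exact: (measurableT_comp (measurable_coord k) measurable_snd).
Qed.

Definition convS Q1 Q2 : probability (seqspace R) R :=
  image_prob (product_prob Q1 Q2) (measurable_pairwise (@measurable_addR R)).

Definition convNS Q1 Q2 : probability (seqspace R) R :=
  image_prob (product_prob Q1 Q2) (measurable_pairwise (@measurable_subR R)).

Definition convS_pow Q n : probability (seqspace R) R :=
  iter n (convS Q) \d_((fun=> 0) : seqspace R).

Let dirac_in d (T : measurableType d) (a : T) (B : set T) :
  B a -> \d_a B = 1%E :> \bar R.
Proof. by move=> Ba; rewrite diracE mem_set. Qed.

Let dirac_notin d (T : measurableType d) (a : T) (B : set T) :
  ~ B a -> \d_a B = 0%E :> \bar R.
Proof. by move=> Ba; rewrite diracE memNset. Qed.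

Lemma iid_law_dirac0 :
  @iid_law R _ R \d_(0 : R) \d_((fun=> 0) : seqspace R).
Proof.
move=> N A mA.
have [A0|/existsNP[k /not_implyP[kN Ak]]] :=
    pselect (forall k, (k < N)%N -> A k (0 : R)).
  rewrite big1 => [|k _]; first by apply: dirac_in.
  by apply: dirac_in; exact: A0.
rewrite (bigD1 (Ordinal kN))//= [X in (X * _)%E](dirac_notin Ak) mul0e.
by apply: dirac_notin => /(_ k kN).
Qed.

Lemma iid_law_convS_pow q Q n : iid_law q Q ->
  iid_law (convR_pow q n) (convS_pow Q n).
Proof.
move=> qQ; elim: n => [|n IH]; first exact: iid_law_dirac0.
exact: iid_law_map2.
Qed.

End sequence_convolution.

Section random_series.
Context (R : realType) (X : completeNormedModType R) (D : nat -> X).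
Hypothesis dD : dense_seq D.
Variables (x : nat -> X) (gamma : nat -> R).

Definition rseries (n : nat) (a : seqspace R) : borel X :=
  series (fun k => (gamma k * a k) *: x k) n.

Definition rcvg : set (seqspace R) := cvg_set rseries.

(** The value 0 at sequences along which the series diverges makes this a total
    measurable function; it is additive on [rcvg] only. *)
Definition rsum : seqspace R -> borel X := lim_or0 rseries.

Lemma measurable_rseries n : measurable_fun setT (rseries n).
Proof.
apply: (measurable_sumB dD) => k; apply: measurable_scaleB.
by apply: measurable_funM => //; exact: measurable_coord.
Qed.

Lemma measurable_rcvg : measurable rcvg.
Proof. exact: (measurable_cvg_set dD measurable_rseries). Qed.

Lemma measurable_rsum : measurable_fun setT rsum.
Proof. exact: (measurable_lim_or0 dD measurable_rseries). Qed.

Lemma rsumP (a : seqspace R) (y : X) :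
  (fun n => rseries n a : X) @ \oo --> y -> rcvg a /\ (rsum a : X) = y.
Proof.
move=> ay; have Ca : rcvg a by apply/cvg_ex; exists y.
by split => //; rewrite /rsum /lim_or0; case: asboolP => // _; exact/cvg_lim.
Qed.

Lemma rcvgP (a : seqspace R) : rcvg a ->
  (fun n => rseries n a : X) @ \oo --> (rsum a : X).
Proof. by move=> Ca; rewrite /rsum /lim_or0; case: asboolP. Qed.

Let lin (e f : R) (p : seqspace R * seqspace R) : seqspace R :=
  fun k => e * p.1 k + f * p.2 k.

Let rseries_lin e f p n : (rseries n (lin e f p) : X) =
  e *: (rseries n p.1 : X) + f *: (rseries n p.2 : X).
Proof.
rewrite /rseries /series/= !scaler_sumr -big_split/=; apply: eq_bigr => k _.
by rewrite !scalerA -scalerDl; congr (_ *: _); rewrite /lin; ring.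
Qed.

(** One computation for the sum and for the half-sum. *)
Let rsum_lin e f p : rcvg p.1 -> rcvg p.2 ->
  rcvg (lin e f p) /\ (rsum (lin e f p) : X) =
    e *: (rsum p.1 : X) + f *: (rsum p.2 : X).
Proof.
move=> C1 C2; apply: rsumP; under eq_fun do rewrite rseries_lin.
apply: cvgD; apply: cvgZr; exact: rcvgP.
Qed.

Lemma rsumD (a b : seqspace R) : rcvg a -> rcvg b ->
  rcvg ((fun k => a k + b k) : seqspace R) /\
  (rsum ((fun k => a k + b k) : seqspace R) : X) = (rsum a : X) + rsum b.
Proof.
move=> Ca Cb; have := rsum_lin 1 1 (p := (a, b)) Ca Cb.
by rewrite /lin/= !scale1r; under eq_fun do rewrite !mul1r.
Qed.

(** [a] is half the sum of [a + b] and [a - b]. *)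
Lemma rcvg_half (a b : seqspace R) :
  rcvg ((fun k => a k + b k) : seqspace R) ->
  rcvg ((fun k => a k - b k) : seqspace R) -> rcvg a.
Proof.
move=> C1 C2.
have [+ _] := rsum_lin 2^-1 2^-1 (p := ((fun k => a k + b k), (fun k => a k - b k))) C1 C2.
suff -> : lin 2^-1 2^-1 ((fun k => a k + b k), (fun k => a k - b k)) = a by [].
by apply/funext => k; rewrite /lin/=; field.
Qed.

Lemma rsum0 : rcvg ((fun=> 0) : seqspace R) /\ (rsum ((fun=> 0) : seqspace R) : X) = 0.
Proof.
apply: rsumP; under eq_fun do rewrite /rseries /series/=.
under eq_fun do under eq_bigr do rewrite mulr0 scale0r.
by under eq_fun do rewrite big1//; exact: cvg_cst.
Qed.

Section products.
Variables Q1 Q2 : probability (seqspace R) R.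

Let mNC : measurable (~` rcvg). Proof. by apply: measurableC; exact: measurable_rcvg. Qed.

Let null1 : product_prob Q1 Q2 (~` rcvg `*` setT) = Q1 (~` rcvg).
Proof.
rewrite product_probX// -[RHS]mule1; congr (_ * _)%E; exact: probability_setT.
Qed.

Let null2 : product_prob Q1 Q2 (setT `*` ~` rcvg) = Q2 (~` rcvg).
Proof.
rewrite product_probX// -[RHS]mul1e; congr (_ * _)%E; exact: probability_setT.
Qed.

(** By [rcvg_half], a sequence [a] of divergence and an arbitrary [b] give
    divergence along [a + b] or along [a - b].  This is the source of almost sure
    convergence for the convolution roots. *)
Lemma rcvg_convS_convNS : convS Q1 Q2 (~` rcvg) = 0%E ->
  convNS Q1 Q2 (~` rcvg) = 0%E -> Q1 (~` rcvg) = 0%E.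
Proof.
move=> s0 d0; apply: etrans (esym null1) _.
pose S := (fun p : seqspace R * seqspace R =>
  (fun k => p.1 k + p.2 k) : seqspace R) @^-1` (~` rcvg).
pose E := (fun p : seqspace R * seqspace R =>
  (fun k => p.1 k - p.2 k) : seqspace R) @^-1` (~` rcvg).
have {}s0 : product_prob Q1 Q2 S = 0%E by exact: s0.
have {}d0 : product_prob Q1 Q2 E = 0%E by exact: d0.
have mS : measurable S.
  rewrite -[X in measurable X]setTI.
  by apply: (measurable_pairwise (@measurable_addR R)) => //; exact: mNC.
have mE : measurable E.
  rewrite -[X in measurable X]setTI.
  by apply: (measurable_pairwise (@measurable_subR R)) => //; exact: mNC.
apply: (@probability_null_subset _ _ _ _ _ (S `|` E)).
- by apply: measurableX.
- exact: measurableU.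
- move=> [a b] [/= nCa _]; apply: contrapT => /not_orP[/contrapT Ca /contrapT Cb].
  by apply: nCa; exact: rcvg_half Ca Cb.
- exact: probability_nullU.
Qed.

Lemma rcvg_convS : Q1 (~` rcvg) = 0%E -> Q2 (~` rcvg) = 0%E ->
  product_prob Q1 Q2 ((~` rcvg `*` setT) `|` (setT `*` ~` rcvg)) = 0%E.
Proof.
move=> z1 z2; apply: probability_nullU.
- exact: measurableX.
- exact: measurableX.
- exact: etrans null1 z1.
- exact: etrans null2 z2.
Qed.

End products.
End random_series.

(** * Convolution powers of the law of a random series *)

Lemma probability_eq_outside d (T : measurableType d) (R : realType)
    (P : probability T R) (A B N : set T) :
  measurable A -> measurable B -> measurable N -> P N = 0%E ->
  (forall t, ~ N t -> A t <-> B t) -> P A = P B.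
Proof.
move=> mA mB mN N0.
suff le (A' B' : set T) : measurable A' -> measurable B' ->
    (forall t, ~ N t -> A' t -> B' t) -> (P A' <= P B')%E.
  by move=> AB; apply/eqP; rewrite eq_le !le// => t /AB[].
move=> mA' mB' AB'; rewrite -[leRHS]adde0 -N0.
apply: le_trans (measureU2 _ _ _) => //; apply: le_measure; rewrite ?inE//.
  exact: measurableU.
by move=> t At; have [Nt|Nt] := pselect (N t); [right|left; exact: AB'].
Qed.

Section convolution_powers.
Context (R : realType) (X : completeNormedModType R) (D : nat -> X).
Hypothesis dD : dense_seq D.
Variables (x : nat -> X) (gamma : nat -> R).
Variable Q : probability (seqspace R) R.

Notation C := (rcvg x gamma).
Notation Phi := (rsum x gamma).

Let mC : measurable (~` C).
Proof. by apply: measurableC; exact: (measurable_rcvg dD). Qed.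

Definition rsum_law (Q' : probability (seqspace R) R) : probability (borel X) R :=
  image_prob Q' (measurable_rsum dD x gamma).

Hypothesis QC : Q (~` C) = 0%E.

Let msum (B : set (seqspace R)) : measurable B ->
  measurable ((fun p : seqspace R * seqspace R =>
    (fun k => p.1 k + p.2 k) : seqspace R) @^-1` B).
Proof.
move=> mB; rewrite -[X in measurable X]setTI.
exact: (measurable_pairwise (@measurable_addR R)).
Qed.

Let mNN : measurable ((~` C `*` setT) `|` (setT `*` ~` C) : set (seqspace R * seqspace R)).
Proof. by apply: measurableU; apply: measurableX. Qed.

Lemma convS_pow_rcvg n : convS_pow Q n (~` C) = 0%E.
Proof.
elim: n => [|n IH].
  rewrite /convS_pow/= /dirac/= indicE memNset//= => h.
  by apply: h; exact: (rsum0 x gamma).1.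
apply: (@probability_null_subset _ _ _ (product_prob Q (convS_pow Q n)) _ _ _ mNN).
- exact: msum.
- move=> [a b] /= nab; apply: contrapT => /not_orP[/= n1 n2]; apply: nab.
  have Ca : C a by apply: contrapT => ?; apply: n1.
  have Cb : C b by apply: contrapT => ?; apply: n2.
  exact: (rsumD Ca Cb).1.
- exact: (rcvg_convS dD QC IH).
Qed.

(** The sum map is additive on pairs of sequences of convergence.  These have
    full measure, so the law of a sum of independent sequences is carried to a
    convolution. *)
Lemma convolution_power_rsum_law n (A : set (borel X)) : measurable A ->
  convolution_power (rsum_law Q) n A = rsum_law (convS_pow Q n) A.
Proof.
elim: n A => [|n IH] A mA.
  have [_ P0] := rsum0 x gamma.
  change (\d_((0 : X) : borel X) A =
    \d_((fun=> 0) : seqspace R) (Phi @^-1` A) :> \bar R).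
  rewrite !diracE.
  suff -> : ((0 : X) \in A) = (((fun=> 0) : seqspace R) \in Phi @^-1` A) by [].
  by apply/idP/idP; rewrite !inE/= P0.
pose Qn := convS_pow Q n.
pose V : set (borel X * seqspace R) := [set p | A ((p.1 : X) + Phi p.2)].
have mV : measurable V.
  rewrite -[V]setTI.
  apply: (measurable_addB dD (f := fun p : borel X * seqspace R => p.1)
    (g := fun p : borel X * seqspace R => Phi p.2)) => //.
    exact: measurable_fst.
  exact: (measurableT_comp (measurable_rsum dD x gamma) measurable_snd).
pose g (y : borel X) := Qn (xsection V y).
have mg : measurable_fun setT g by exact: measurable_fun_xsection.
have VE y : xsection V y = Phi @^-1` [set z | A ((y : X) + z)].
  by apply/seteqP; split => b /=; rewrite /xsection/= inE.
transitivity (\int[rsum_law Q]_y g y)%E.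
  apply: eq_integral => y _; rewrite /g VE.
  apply: etrans (IH [set z | A ((y : X) + z)] _) _ => //.
  rewrite -[X in measurable X]setTI.
  apply: (measurable_addB dD (f := fun=> y) (g := fun z : borel X => z)) => //.
rewrite ge0_integral_image//.
transitivity (product_prob Q Qn [set p | A ((Phi p.1 : X) + Phi p.2)]).
  rewrite product_prob_fubini.
    apply: eq_integral => a _; rewrite /g VE.
    by [].
  rewrite -[X in measurable X]setTI.
  apply: (measurable_addB dD (f := fun p : seqspace R * seqspace R => Phi p.1)
    (g := fun p : seqspace R * seqspace R => Phi p.2)) => //.
    exact: (measurableT_comp (measurable_rsum dD x gamma) measurable_fst).
  exact: (measurableT_comp (measurable_rsum dD x gamma) measurable_snd).
apply: (@probability_eq_outside _ _ _ (product_prob Q Qn) _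
  ((fun p : seqspace R * seqspace R =>
    (fun k => p.1 k + p.2 k) : seqspace R) @^-1` (Phi @^-1` A)) _ _ _ mNN).
- rewrite -[X in measurable X]setTI.
  apply: (measurable_addB dD (f := fun p : seqspace R * seqspace R => Phi p.1)
    (g := fun p : seqspace R * seqspace R => Phi p.2)) => //.
    exact: (measurableT_comp (measurable_rsum dD x gamma) measurable_fst).
  exact: (measurableT_comp (measurable_rsum dD x gamma) measurable_snd).
- apply: msum; rewrite -[X in measurable X]setTI.
  exact: (measurable_rsum dD x gamma).
- exact: (rcvg_convS dD QC (convS_pow_rcvg n)).
- move=> [a b] /not_orP[/= n1 n2].
  have Ca : C a by apply: contrapT => ?; apply: n1.
  have Cb : C b by apply: contrapT => ?; apply: n2.
  by rewrite (rsumD Ca Cb).2.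
Qed.

End convolution_powers.

(** * The exponent along a continuous linear functional *)

Section jump_bound.
Context (R : realType).

(** Mean value theorem. *)
Lemma normr_sin_le (y : R) : `|sin y| <= `|y|.
Proof.
wlog y0 : y / 0 <= y.
  have [y0|/ltW y0] := leP 0 y; first exact.
  by move=> /(_ (- y)); rewrite sinN !normrN oppr_ge0; apply.
move: y0; rewrite le_eqVlt => /orP[/eqP <-|y0]; first by rewrite sin0.
have [|c _] := @MVT R (@sin R) (@cos R) 0 y y0 (fun c _ => is_derive_sin c).
  by apply: continuous_subspaceT => c; exact: continuous_sin.
rewrite sin0 !subr0 => ->.
by rewrite normrM ler_piMl// cos_max.
Qed.

Lemma one_sub_cos_bound (y : R) : 0 <= 1 - cos y <= y ^+ 2 / 2.
Proof.
rewrite subr_ge0 cos_le1/=.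
have -> : 1 - cos y = 2 * sin (y / 2) ^+ 2.
  have yE : y = (y / 2) *+ 2 by rewrite -mulr_natr divfK.
  rewrite {1}yE cos_mulr2n; have := cos2Dsin2 (y / 2); lra.
have -> : y ^+ 2 / 2 = 2 * (y / 2) ^+ 2 by field.
by rewrite ler_pM2l// -(real_normK (num_real (sin _))) -[leRHS]real_normK ?num_real//
  lerXn2r ?nnegrE ?normr_ge0// normr_sin_le.
Qed.

Variable lambda : {finite_measure set (measurableTypeR R) -> \bar R}.

(** Integrate [1 - cos y <= y ^+ 2 / 2]. *)
Lemma jump_bound (c : R) :
  lambda.-integrable [set: measurableTypeR R]
     (fun t => (Num.max 1 (`|t| ^+ 2))%:E) ->
  0 <= - (\int[lambda]_t (cos (c * t) - 1)) <=
    c ^+ 2 * (\int[lambda]_t (Num.max 1 (`|t| ^+ 2) : R)).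
Proof.
move=> iM.
have i1 : lambda.-integrable setT (EFin \o (fun t : R => 1 - cos (c * t))).
  apply: (@finite_measure_bounded_integrable _ _ _ _ _ 2) => [|t].
    by apply: measurable_funB => //; exact: measurable_cosM.
  by rewrite (le_trans (ler_normB _ _))// normr1 -[leRHS]/(1 + 1) lerD2l cos_max.
have -> : - (\int[lambda]_t (cos (c * t) - 1)) = \int[lambda]_t (1 - cos (c * t)).
  have iN : lambda.-integrable setT (EFin \o (fun t : R => cos (c * t) - 1)).
    apply: eq_integrable (integrableN i1) => // t _ /=.
    by rewrite opprB.
  have := RintegralZl (-1) measurableT iN.
  rewrite mulN1r => <-; apply: eq_Rintegral => t _; by rewrite mulN1r opprB.
apply/andP; split.
  by apply: Rintegral_ge0 => //; move=> t _; have /andP[] := one_sub_cos_bound (c * t).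
rewrite -RintegralZl//; apply: le_Rintegral => //.
  have := integrableZl measurableT (c ^+ 2) iM; exact.
move=> t _; have /andP[_ /le_trans] := one_sub_cos_bound (c * t); apply.
rewrite exprMn -mulrA ler_wpM2l ?sqr_ge0//.
rewrite le_max; apply/orP; right.
by rewrite real_normK ?num_real// ler_piMr ?sqr_ge0// invf_le1// ler1n.
Qed.

End jump_bound.

(** Continuity at 0 bounds the functional on a small ball, hence, by
    homogeneity, on the unit sphere. *)
Lemma continuous_linear_bound (R : realType) (X : normedModType R)
    (rho : {linear X -> R^o}) : continuous rho ->
  exists2 B : R, 0 <= B & forall y : X, `|y| = 1 -> `|rho y : R| <= B.
Proof.
move=> crho.
have /cvgrPdist_lt /(_ 1 ltr01) := crho 0.
rewrite linear0 => /nbhs_ballP[e /= e0 He].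
have e2 : 0 < e / 2 by rewrite divr_gt0.
exists (e / 2)^-1; first by rewrite invr_ge0 ltW.
move=> y y1.
have /He : ball (0 : X) e ((e / 2) *: y).
  rewrite -ball_normE/= sub0r normrN normrZ y1 mulr1 gtr0_norm//.
  by rewrite ltr_pdivrMr// mulr_natr mulr2n ltrDl.
rewrite /= sub0r normrN linearZ /= normrM gtr0_norm// => h.
by rewrite -[leRHS]mul1r ler_pdivlMr// mulrC ltW.
Qed.

(** * The characteristic function of a random series *)

Section charfun_random_series.
Context (R : realType) (X : completeNormedModType R) (D : nat -> X).
Hypothesis dD : dense_seq D.
Variables (x : nat -> X) (gamma : nat -> R).
Variables (q : probability R R) (psi : R -> R) (Q : probability (seqspace R) R).
Hypotheses (qpsi : symmetric_charfun q psi) (iidQ : iid_law q Q).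
Hypothesis QC : Q (~` rcvg x gamma) = 0%E.
Variable rho : {linear X -> R^o}.
Hypothesis crho : continuous rho.

Let c k : R := gamma k * rho (x k).

Let measurable_rho : measurable_fun setT (rho : borel X -> R).
Proof.
apply: (@measurability _ _ (borel X) R setT _ _ (RGenOpens.measurableE R)).
move=> _ [_ [a [b ->]] <-]; rewrite setTI; apply: measurable_open.
move/continuousP : crho; apply; exact: itv_open.
Qed.

Let rho_rseries N (a : seqspace R) :
  (rho (rseries x gamma N a : X) : R) = \sum_(k < N) c k * a k.
Proof.
rewrite /rseries /series/= linear_sum big_mkord; apply: eq_bigr => k _.
by rewrite linearZ/= /c mulrAC.
Qed.

(** Almost surely the partial sums converge in norm, hence their images under
    the continuous functional [rho] converge; [trig] is bounded, so dominated
    convergence applies. *)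
Let cvg_trig (trig : R -> R) : continuous trig -> (forall y, `|trig y| <= 1) ->
  \int[Q]_a trig (\sum_(k < N) c k * a k) @[N --> \oo] -->
  \int[rsum_law dD x gamma Q]_u trig (rho (u : X)).
Proof.
move=> ct t1.
have mt : measurable_fun setT trig by exact: continuous_measurable_fun.
have mtr : measurable_fun setT (fun u : borel X => trig (rho (u : X))).
  exact: measurableT_comp.
rewrite (Rintegral_image Q (measurable_rsum dD x gamma) mtr (fun u => t1 _)).
apply: (@Rintegral_dominated_cvg _ _ _ Q _ _ (cst 1)) => //.
- move=> N.
  apply: (eq_measurable_fun (fun a => trig (rho (rseries x gamma N a : X)))) => [a _|].
    by rewrite rho_rseries.
  exact: (measurableT_comp mtr (measurable_rseries dD x gamma N)).
- exact: (measurableT_comp mtr (measurable_rsum dD x gamma)).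
- exists (~` rcvg x gamma); split.
  + by apply: measurableC; exact: (measurable_rcvg dD).
  + exact: QC.
  + move=> a /= na Ca; apply: na.
    under eq_fun do rewrite -rho_rseries.
    apply: (continuous_cvg _ (ct _)).
    have h := cvg_comp _ _ (rcvgP Ca) (@crho (rsum x gamma a)).
    exact: h.
- apply: (@finite_measure_bounded_integrable _ _ _ Q _ 1) => //= a.
  by rewrite normr1.
Qed.

Lemma charfun_rsum_law :
  \prod_(k < N) psi (c k) @[N --> \oo] -->
    \int[rsum_law dD x gamma Q]_u cos (rho (u : X)) /\
  \int[rsum_law dD x gamma Q]_u sin (rho (u : X)) = 0.
Proof.
split.
  have := cvg_trig (@continuous_cos R) (@cos_max R).
  by under eq_fun do rewrite (iid_charfun_sum qpsi iidQ _ _).1.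
have := cvg_trig (@continuous_sin R) (@sin_max R).
under eq_fun do rewrite (iid_charfun_sum qpsi iidQ _ _).2.
by move=> /cvg_lim <-//; rewrite lim_cst.
Qed.

End charfun_random_series.

Section levy_khintchine_series.
Context (R : realType) (X : normedModType R).
Variables (x : nat -> X) (gamma : nat -> R) (sigma : R).
Hypotheses (x_norm : normalized x) (gamma_l2 : ell2 gamma).
Variable lambda : {finite_measure set (measurableTypeR R) -> \bar R}.
Hypothesis lambda_mom : lambda.-integrable [set: measurableTypeR R]
  (fun t => (Num.max 1 (`|t| ^+ 2))%:E).
Variable rho : {linear X -> R^o}.
Hypothesis crho : continuous rho.

Let coef k : R := gamma k * rho (x k).
Let gauss_term k : R := sigma ^+ 2 * gamma k ^+ 2 * rho (x k) ^+ 2.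
Let jump_term k : R := \int[lambda]_t (cos (coef k * t) - 1).

Lemma cvg_gauss_series : cvgn (series gauss_term).
Proof.
have [B B0 rhoB] := continuous_linear_bound crho.
apply: (@series_le_cvg _ _ (fun k => sigma ^+ 2 * B ^+ 2 * gamma k ^+ 2)).
- by move=> k; repeat (exact: sqr_ge0 || apply: mulr_ge0).
- by move=> k; repeat (exact: sqr_ge0 || apply: mulr_ge0).
- move=> k; rewrite /gauss_term mulrAC ler_wpM2r ?sqr_ge0// ler_wpM2l ?sqr_ge0//.
  by rewrite -[leLHS]real_normK ?num_real// lerXn2r ?nnegrE// rhoB.
- exact: is_cvg_seriesZ.
Qed.

Lemma cvg_jump_series : cvgn (series jump_term).
Proof.
have [B B0 rhoB] := continuous_linear_bound crho.
set M := \int[lambda]_t (Num.max 1 (`|t| ^+ 2) : R).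
have M0 : 0 <= M.
  by apply: Rintegral_ge0 => // t _; rewrite le_max ler01.
have -> : jump_term = - (fun k => - jump_term k).
  by apply/funext => k /=; rewrite opprK.
rewrite is_cvg_seriesN.
apply: (@series_le_cvg _ (fun k => - jump_term k) (fun k => M * B ^+ 2 * gamma k ^+ 2)).
- by move=> k; have /andP[] := jump_bound (coef k) lambda_mom.
- by move=> k; repeat (exact: sqr_ge0 || exact: M0 || apply: mulr_ge0).
- move=> k; have /andP[_ /le_trans] := jump_bound (coef k) lambda_mom; apply.
  rewrite -/M mulrC -mulrA ler_wpM2l// /coef exprMn mulrC ler_wpM2r ?sqr_ge0//.
  by rewrite -[leLHS]real_normK ?num_real// lerXn2r ?nnegrE// rhoB.
- exact: is_cvg_seriesZ.
Qed.

(** The product of exponentials is the exponential of the partial sums of the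
    two series. *)
Lemma cvg_prod_levy_khintchine :
  \prod_(k < N) expR (- (sigma ^+ 2 * coef k ^+ 2 / 2) +
    \int[lambda]_t (cos (coef k * t) - 1)) @[N --> \oo] -->
  expR (- (2^-1 * limn (series gauss_term)) + limn (series jump_term)).
Proof.
have -> : (fun N => \prod_(k < N) expR (- (sigma ^+ 2 * coef k ^+ 2 / 2) +
    \int[lambda]_t (cos (coef k * t) - 1))) =
  (fun N => expR (- (2^-1 * series gauss_term N) + series jump_term N)).
  apply/funext => N; rewrite -expR_sum; congr expR.
  rewrite big_split/= /series/= !big_mkord; congr (_ + _).
  rewrite mulr_sumr -sumrN; apply: eq_bigr => k _.
  by rewrite /gauss_term /coef exprMn; congr (- _); ring.
apply: continuous_cvg; first exact: continuous_expR.
apply: cvgD; last exact: cvg_jump_series.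
by apply: cvgN; apply: cvgMr; exact: cvg_gauss_series.
Qed.

End levy_khintchine_series.

(** * Convolution roots of a product prior *)

Section law_of_random_series.
Context (R : realType) (X : completeNormedModType R) (D : nat -> X).
Hypothesis dD : dense_seq D.
Variables (x : nat -> X) (gamma : nat -> R).

(** Off a null set the random vector is the sum of the series along the
    sequence [xi], so its law is the image of the law of that sequence. *)
Lemma product_prior_rsum_law d (T : measurableType d) (P : probability T R)
    (xi : nat -> {RV P >-> R}) (mu : probability (borel X) R) :
  product_prior x gamma xi mu ->
  let Q := image_prob P (measurable_rv_seq xi) in
  Q (~` rcvg x gamma) = 0%E /\
  forall A, measurable A -> mu A = rsum_law dD x gamma Q A.
Proof.
move=> [u [[N [mN N0 uN]] muE]] /=.
pose seq_xi w : seqspace R := fun k => xi k w.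
have mseq : measurable_fun setT seq_xi by exact: measurable_rv_seq.
have mpre B : measurable B -> measurable (seq_xi @^-1` B).
  by move=> mB; rewrite -[X in measurable X]setTI; exact: mseq.
have uP w : ~ N w -> rcvg x gamma (seq_xi w) /\
    (rsum x gamma (seq_xi w) : X) = (u w : X).
  move=> nNw; apply: rsumP.
  by apply: contrapT => ncvg; apply: nNw; apply: uN => /= ?; exact: ncvg.
split.
  apply: (@probability_null_subset _ _ _ P (seq_xi @^-1` (~` rcvg x gamma)) N) => //.
    by apply: mpre; apply: measurableC; exact: (measurable_rcvg dD).
  by move=> w /= nC; apply: contrapT => /uP[].
move=> A mA; rewrite muE//.
apply: (@probability_eq_outside _ _ _ P (u @^-1` A)
  (seq_xi @^-1` (rsum x gamma @^-1` A)) N) => //.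
- by rewrite -[X in measurable X]setTI; exact: measurable_funPT.
- by apply: mpre; rewrite -[X in measurable X]setTI; exact: (measurable_rsum dD).
- by move=> w /uP[_ e]; rewrite /preimage/= e.
Qed.

Variables (q : probability R R) (psi : R -> R) (Q : probability (seqspace R) R).
Hypotheses (qpsi : symmetric_charfun q psi) (iidQ : iid_law q Q).
Hypothesis QC : Q (~` rcvg x gamma) = 0%E.

(** Let the sequence [a] have independent coordinates of law [rho]; it is
    obtained from one of law [Q] by a quantile transform of each coordinate.
    Let [b] be the sum of [n] independent copies of [a], independent of [a].
    The characteristic functions of a coordinate of [a + b] and of [a - b] are
    both [theta ^+ n.+1], that is [psi], so [a + b] and [a - b] both have law
    [Q].  Hence the series converges almost surely along both, and then along
    [a].  The law [nu] of its sum along [a] is the required root because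
    [a + b] is a sum of [n.+1] independent copies of [a]. *)
Lemma rsum_law_root (q_atomless : forall y, q [set y] = 0%E)
    (rho : probability R R) (theta : R -> R) (n : nat) :
  symmetric_charfun rho theta -> (forall z, theta z ^+ n.+1 = psi z) ->
  exists nu : probability (borel X) R, forall A, measurable A ->
    rsum_law dD x gamma Q A = convolution_power nu n.+1 A.
Proof.
move=> rho_theta theta_psi.
have [h [mh hq]] := quantile_transform q_atomless rho.
have mH : measurable_fun setT (fun a : seqspace R => (fun k => h (a k)) : seqspace R).
  apply: measurable_seqspace => k.
  exact: (measurableT_comp mh (measurable_coord k)).
pose Qn := image_prob Q mH.
have iidQn : iid_law rho Qn.
  have := @iid_law_map R _ R _ R q Q h mh mH iidQ.
  by apply: eq_iid_law => A mA; exact: hq.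
have iidn := iid_law_convS_pow n iidQn.
have thetan := symmetric_charfun_convR_pow n rho_theta.
have lawE (g : probability R R) (Qg : probability (seqspace R) R) :
    symmetric_charfun g (fun z => theta z * theta z ^+ n) -> iid_law g Qg ->
    forall B, measurable B -> Q B = Qg B.
  move=> gc iidg; apply: iid_law_unique iidQ _; apply: eq_iid_law iidg.
  apply: symmetric_charfun_unique gc _ => z.
  by rewrite -exprS theta_psi; exact: qpsi.
have mC : measurable (~` rcvg x gamma).
  by apply: measurableC; exact: (measurable_rcvg dD).
have sumE : forall B, measurable B -> Q B = convS Qn (convS_pow Qn n) B.
  apply: (lawE (convR rho (convR_pow rho n))).
    exact: symmetric_charfun_convR.
  exact: iid_law_map2.
have subE : forall B, measurable B -> Q B = convNS Qn (convS_pow Qn n) B.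
  apply: (lawE (convNR rho (convR_pow rho n))).
    exact: symmetric_charfun_convNR.
  exact: iid_law_map2.
have QnC : Qn (~` rcvg x gamma) = 0%E.
  apply: (rcvg_convS_convNS dD (Q2 := convS_pow Qn n)).
    exact: etrans (esym (sumE _ mC)) QC.
  exact: etrans (esym (subE _ mC)) QC.
exists (rsum_law dD x gamma Qn) => A mA.
rewrite (convolution_power_rsum_law dD QnC)//; apply: sumE.
by rewrite -[X in measurable X]setTI; exact: (measurable_rsum dD).
Qed.

End law_of_random_series.

Local Open Scope complex_scope.

Theorem theorem2p18 (R : realType) (X : completeNormedModType R)
  (x : nat -> X)
  (x_basis : unconditional_schauder_basis x) (x_norm : normalized x)
  (gamma : nat -> R) (gamma_l2 : ell2 gamma)
  (d : measure_display) (T : measurableType d) (P : probability T R)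
  (xi : nat -> {RV P >-> R}) (xi_iid : iid xi)
  (sigma : R) (sigma_gt0 : 0 < sigma)
  (lambda : {finite_measure set (measurableTypeR R) -> \bar R})
  (lambda_levy : levy_measure lambda) (lambda_sym : symmetric_measure lambda)
  (lambda_mom : lambda.-integrable [set: measurableTypeR R]
     (fun t => (Num.max 1 (`|t| ^+ 2))%:E))
  (xi_ID : forall k : nat, ID0 (xi k) (sigma ^+ 2) lambda)
  (mu : probability (borel X) R) (mu_prior : product_prior x gamma xi mu) :
  [/\ radon mu,
      infinitely_divisible mu &
      forall rho : {linear X -> R^o}, continuous rho ->
        let gauss := series (fun k : nat =>
          sigma ^+ 2 * gamma k ^+ 2 * rho (x k) ^+ 2) in
        let jump := series (fun k : nat =>
          (\int[lambda]_t (cos (gamma k * rho (x k) * t) - 1))%R) in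
        [/\ cvgn gauss, cvgn jump &
            charfun mu rho =
              (expR (- (2^-1 * limn gauss) + limn jump))%:C]].
Proof.
have dD := basis_dense_seq x_basis.1 x_norm.
have [QC muE] := product_prior_rsum_law dD mu_prior.
set Q := image_prob P _ in QC muE.
pose q : probability R R := distribution P (xi 0%N).
have iidQ : iid_law q Q by exact: iid_iid_law.
have qpsi := ID0_symmetric_charfun lambda_sym (xi_ID 0%N).
rewrite -/q in qpsi.
have sigma_neq0 : sigma != 0 by rewrite gt_eqF.
(* the root of order one of the Levy-Khintchine law is atomless, and it is [q] *)
have q_atomless y : q [set y] = 0%E.
  have [q' [theta [q'0 q'C thetaE]]] := gauss_poisson_root lambda_sym sigma_neq0 (ltn0Sn 0).
  rewrite -(q'0 y); apply: (symmetric_charfun_unique qpsi) => // z.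
  by rewrite -thetaE expr1; exact: q'C.
split; first exact: (borel_prob_radon dD).
  case=> // n _.
  have [q' [theta [_ q'C thetaE]]] := gauss_poisson_root lambda_sym sigma_neq0 (ltn0Sn n).
  have [nu nuE] := rsum_law_root dD qpsi iidQ QC q_atomless q'C thetaE.
  exists nu; split; first exact: (borel_prob_radon dD).
  by move=> A mA; rewrite muE// nuE.
move=> rho crho gauss jump; split.
- exact: cvg_gauss_series.
- exact: cvg_jump_series.
have intE (f : X -> R) : \int[mu]_u f u = \int[rsum_law dD x gamma Q]_u f u.
  by rewrite /Rintegral; congr fine; apply: eq_measure_integral => A mA _; exact: muE.
have [cosE sinE] := charfun_rsum_law dD qpsi iidQ QC crho.
rewrite /charfun /cintegral /cexp/= expR0.
under [X in X +i* _]eq_Rintegral do rewrite mul1r.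
under [X in _ +i* X]eq_Rintegral do rewrite mul1r.
rewrite !intE sinE; congr (_ +i* _).
apply: cvg_unique cosE _ => //.
exact: cvg_prod_levy_khintchine.
Qed.
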